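(* Let $d\ge1$, $L>0$, and let $\sigma_1,\sigma_2,\dots$ be i.i.d. random reflections of $\mathbb{R}^d$ with law $\mathbb{P}(\sigma_i(0)\in B)=(2L\omega_d)^{-1}\int_{B\cap B_{2L}}|x|^{-(d-1)}\,dx$. If $f\in L^p(B_L)$, $f\ge0$, with $p>1$ and $\frac1p+\frac1q=1$, then $$\mathbb{E}\big[\|f^{\sigma_1\cdots\sigma_n}-f^*\|_1\big]=O(n^{-1/q})\quad\text{as } n\to\infty .$$
   Context: $m$ is Lebesgue measure on $\mathbb{R}^d$; $B_r$ is the ball of radius $r$ centered at the origin; $\omega_d$ is the surface area of $B_1$. Functions in $L^p(B_L)$ are regarded as functions on $\mathbb{R}^d$ vanishing outside $B_L$. Polarization: let $\Omega$ be the set of reflections of $\mathbb{R}^d$ across affine hyperplanes that do not map the origin to itself (a reflection $\sigma\in\Omega$ is determined by the point $\sigma(0)\ne 0$). For $\sigma\in\Omega$, let $X_0^\sigma$ be the hyperplane fixed by $\sigma$, $X_+^\sigma$ the open half-space of its complement containing $0$ and $X_-^\sigma$ the other one. The polarization of $f$ is $f^\sigma(x)=\max(f(x),f(\sigma(x)))$ for $x\in X_+^\sigma$, $f^\sigma(x)=\min(f(x),f(\sigma(x)))$ for $x\in X_-^\sigma$, and $f^\sigma(x)=f(x)$ for $x\in X_0^\sigma$. $f^{\sigma_1\cdots\sigma_n}$ denotes the result of polarizing successively with respect to $\sigma_1$, then $\sigma_2$, ..., then $\sigma_n$. Symmetrization: for measurable $A$ of finite measure, $A^*$ is the open ball centered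 at the origin with $m(A^* )=m(A)$; for nonnegative $f$ with $m(\{f>t\})<\infty$ for all $t>0$, $f^*(x)=\sup\{t:x\in\{f>t\}^*\}$. *)

(* Defs.v *)
From HB Require Import structures.
From mathcomp Require Import all_boot all_order all_algebra.
From mathcomp Require Import all_classical all_reals all_analysis.
From mathcomp Require Import ring lra.
Import Order.TTheory GRing.Theory Num.Theory.
Import numFieldNormedType.Exports.

Set Implicit Arguments.
Unset Strict Implicit.
Unset Printing Implicit Defensive.

Local Open Scope classical_set_scope.
Local Open Scope ring_scope.

Definition measure_rV_display : measure_display.
Proof. exact: default_measure_display. Qed.

Section measurable_rV.
Variables (R : realType) (n : nat).

Let coord (i : 'I_n) (x : 'rV[R]_n) : measurableTypeR R := x ord0 i.

Let rV_set0 : g_sigma_preimage coord set0.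
Proof. exact: sigma_algebra0. Qed.

Let rV_setC A : g_sigma_preimage coord A -> g_sigma_preimage coord (~` A).
Proof. exact: sigma_algebraC. Qed.

Let rV_bigcup (F : _^nat) : (forall i, g_sigma_preimage coord (F i)) ->
  g_sigma_preimage coord (\bigcup_i (F i)).
Proof. exact: sigma_algebra_bigcup. Qed.

(* The measurable sets are generated by the coordinates: these are the Borel
   sets of R^n. *)
HB.instance Definition _ := @isMeasurable.Build measure_rV_display
  'rV[R]_n (g_sigma_preimage coord) rV_set0 rV_setC rV_bigcup.

Lemma measurable_coord (i : 'I_n) :
  measurable_fun [set: 'rV[R]_n] (fun x : 'rV[R]_n => x ord0 i).
Proof.
move=> _ Y mY; rewrite setTI; apply: sub_sigma_algebra => /=.
rewrite -bigcup_seq/=; exists i => /=; first by rewrite mem_index_enum.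
by exists Y => //; rewrite setTI.
Qed.

Lemma measurable_fun_rV d (T : measurableType d) (f : T -> 'rV[R]_n) :
  (forall i, measurable_fun [set: T] (fun t => f t ord0 i)) ->
  measurable_fun [set: T] f.
Proof.
move=> mf.
have H : g_sigma_preimage (fun i => coord i \o f) `<=` measurable.
  apply: smallest_sub; first exact: sigma_algebra_measurable.
  move=> A; rewrite -bigcup_seq/= => -[i _ [B mB <-]].
  exact: mf.
move=> _ A mA; apply: H; rewrite g_sigma_preimage_comp.
by exists A.
Qed.

End measurable_rV.

Section rV_cons.
Variables (R : realType) (n : nat).

Definition rV_cons (z : R * 'rV[R]_n) : 'rV[R]_n.+1 :=
  \row_i (if unlift ord0 i is Some j then z.2 ord0 j else z.1).

Definition rV_uncons (x : 'rV[R]_n.+1) : R * 'rV[R]_n :=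
  (x ord0 ord0, \row_j x ord0 (lift ord0 j)).

Lemma rV_consK : cancel rV_cons rV_uncons.
Proof.
move=> [a x]; rewrite /rV_uncons /rV_cons mxE unlift_none; congr pair.
by apply/rowP => j; rewrite !mxE liftK.
Qed.

Lemma measurable_rV_cons :
  measurable_fun [set: measurableTypeR R * 'rV[R]_n] rV_cons.
Proof.
apply: measurable_fun_rV => i; case: (unliftP ord0 i) => [j ->|->].
- rewrite (_ : (fun _ => _) = (fun x : 'rV[R]_n => x ord0 j) \o snd).
    by apply: measurableT_comp => //; exact: measurable_coord.
  by apply/funext => z /=; rewrite mxE liftK.
- rewrite (_ : (fun _ => _) = fst); first exact: measurable_fst.
  by apply/funext => z; rewrite mxE unlift_none.
Qed.

Lemma measurable_rV_uncons :
  measurable_fun [set: 'rV[R]_n.+1]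
    (rV_uncons : _ -> measurableTypeR R * 'rV[R]_n).
Proof.
apply/measurable_fun_pairP; split; first exact: measurable_coord.
apply: measurable_fun_rV => i /=.
rewrite (_ : (fun _ => _) = fun x : 'rV[R]_n.+1 => x ord0 (lift ord0 i)).
  exact: measurable_coord.
by apply/funext => x /=; rewrite mxE.
Qed.

End rV_cons.

Section lebesgue_succ.
Variables (R : realType) (n : nat).
Variable m : {sigma_finite_measure set 'rV[R]_n -> \bar R}.

Definition lebesgue_succ : set 'rV[R]_n.+1 -> \bar R :=
  pushforward (@lebesgue_measure R \x m)%E (@rV_cons R n).


Let lebesgue_succ0 : lebesgue_succ set0 = 0%E.
Proof. by rewrite /lebesgue_succ /pushforward preimage_set0 measure0. Qed.

Let lebesgue_succ_ge0 A : (0 <= lebesgue_succ A)%E.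
Proof. by rewrite /lebesgue_succ /pushforward; exact: measure_ge0. Qed.

Let lebesgue_succ_sigma_additive : semi_sigma_additive lebesgue_succ.
Proof.
have mf A : measurable A -> measurable (@rV_cons R n @^-1` A).
  by move=> mA; rewrite -[X in measurable X]setTI; exact: measurable_rV_cons.
move=> F mF tF mUF; rewrite /lebesgue_succ /pushforward preimage_bigcup.
apply: measure_semi_sigma_additive.
- by move=> k; exact: mf.
- apply/trivIsetP => /= i j _ _ ij; rewrite -preimage_setI.
  by move/trivIsetP : tF => /(_ _ _ _ _ ij) ->//; rewrite preimage_set0.
- by rewrite -preimage_bigcup; exact: mf.
Qed.

HB.instance Definition _ := isMeasure.Build _ _ _ lebesgue_succ
  lebesgue_succ0 lebesgue_succ_ge0 lebesgue_succ_sigma_additive.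

Let lebesgue_succ_sigma_finite : sigma_finite setT lebesgue_succ.
Proof.
have /sigma_finiteP[F [TF ndF Foo]] := sigma_finiteT (@lebesgue_measure R).
have /sigma_finiteP[G [TG ndG Goo]] := sigma_finiteT m.
exists (fun k => @rV_uncons R n @^-1` (F k `*` G k)).
  rewrite -preimage_bigcup (_ : \bigcup_k _ = setT) ?preimage_setT//.
  rewrite -setXTT TF TG predeqE => -[x y]; split.
    by move=> [k _ []/= ? ?]; split; exists k.
  move=> [/= [k _ Fkx] [l _ Gly]]; exists (maxn k l) => //; split.
  - by move: x Fkx; exact/subsetPset/ndF/leq_maxl.
  - by move: y Gly; exact/subsetPset/ndG/leq_maxr.
move=> k; have [mF ltF] := Foo k; have [mG ltG] := Goo k; split.
  rewrite -[X in measurable X]setTI; apply: measurable_rV_uncons => //.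
  exact: measurableX.
rewrite /lebesgue_succ /pushforward -comp_preimage.
rewrite (_ : _ \o _ = id); last by apply/funext => z /=; rewrite rV_consK.
by rewrite preimage_id product_measure1E// lte_mul_pinfty// ge0_fin_numE.
Qed.

HB.instance Definition _ := Measure_isSigmaFinite.Build _ _ _ lebesgue_succ
  lebesgue_succ_sigma_finite.

End lebesgue_succ.

Fixpoint lebesgue_rV (R : realType) (n : nat) :
    {sigma_finite_measure set 'rV[R]_n -> \bar R} :=
  if n is n'.+1 return {sigma_finite_measure set 'rV[R]_n -> \bar R}
  then lebesgue_succ (lebesgue_rV R n')
  else \d_(0 : 'rV[R]_0).

Lemma lebesgue_rV_box (R : realType) (n : nat) (A : 'I_n -> set R) :
  (forall i, measurable (A i)) ->
  lebesgue_rV R n [set x | forall i, A i (x ord0 i)] =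
  (\prod_(i < n) lebesgue_measure (A i : set (measurableTypeR R)))%E.
Proof.
elim: n A => [|n IH] A mA.
  rewrite big_ord0 /= diracE mem_set//=; by case.
rewrite big_ord_recl -IH; last by move=> i; exact: mA.
rewrite /= /lebesgue_succ /pushforward -product_measure1E//.
- congr (_ _); apply/seteqP; split => [[a x] /= H|[a x] /= [H0 H] i].
  + split=> [|i]; first by have := H ord0; rewrite mxE unlift_none.
    by have := H (lift ord0 i); rewrite mxE liftK.
  + by case: (unliftP ord0 i) => [j ->|->]; rewrite mxE ?liftK ?unlift_none.
- exact: mA.
- rewrite [X in measurable X](_ : _ = \bigcap_(i in [set: 'I_n])
      ((fun x : 'rV[R]_n => x ord0 i) @^-1` A (lift ord0 i))).
    apply: fin_bigcap_measurable; first exact: finite_finset.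
    by move=> i _; rewrite -[X in measurable X]setTI; exact: measurable_coord.
  by apply/seteqP; split => x /= H i; have := H i; try exact.
Qed.

Section euclid.
Variables (R : realType) (d : nat).
Implicit Types (x y u a : 'rV[R]_d) (s : 'rV[R]_d -> 'rV[R]_d).

Definition dotv x y : R := \sum_(i < d) x ord0 i * y ord0 i.

(* The norm `|x| of the library on 'rV[R]_d is the sup norm. *)
Definition enorm x : R := Num.sqrt (dotv x x).

Definition eball (r : R) : set 'rV[R]_d := [set x | enorm x < r].

(* Surface measure of a part E of the unit sphere, by the cone construction. *)
Definition sphere_measure (E : set 'rV[R]_d) : \bar R :=
  (d%:R%:E * lebesgue_rV R d
     [set x | exists (t : R) u, [/\ 0 < t <= 1, E u & x = t *: u]]%R)%E.

Definition omega : \bar R := sphere_measure [set u | enorm u = 1].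

(* The reflection across the affine hyperplane [dotv x u = c], [u != 0]. *)
Definition reflect u (c : R) x : 'rV[R]_d :=
  x - (2 * (dotv x u - c) / dotv u u) *: u.

Definition Omega : set ('rV[R]_d -> 'rV[R]_d) :=
  [set s | (exists u c, u != 0 /\ s = reflect u c) /\ s 0 != 0].

(* For [s] in [Omega] the hyperplane fixed by [s] is the perpendicular bisector
   of the segment from 0 to [s 0] (lemma [mirrorE] below), so that the open
   half-spaces it bounds are [mirror_pos s], which contains 0, and
   [mirror_neg s]. *)
Definition mirror s : set 'rV[R]_d := [set x | s x = x].
Definition mirror_pos s : set 'rV[R]_d :=
  [set x | dotv x (s 0) < dotv (s 0) (s 0) / 2].
Definition mirror_neg s : set 'rV[R]_d :=
  [set x | dotv (s 0) (s 0) / 2 < dotv x (s 0)].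

Lemma dotvDl x y u : dotv (x + y) u = dotv x u + dotv y u.
Proof. by rewrite -big_split; apply: eq_bigr => i _; rewrite mxE mulrDl. Qed.

Lemma dotvZl (a : R) x u : dotv (a *: x) u = a * dotv x u.
Proof. by rewrite mulr_sumr; apply: eq_bigr => i _; rewrite mxE mulrA. Qed.

Lemma dotvC x y : dotv x y = dotv y x.
Proof. by apply: eq_bigr => i _; rewrite mulrC. Qed.

Lemma dotv0l x : dotv 0 x = 0.
Proof. by rewrite /dotv big1// => i _; rewrite mxE mul0r. Qed.

Lemma dotv_gt0 u : u != 0 -> 0 < dotv u u.
Proof.
move=> u0; rewrite lt_def sumr_ge0 ?andbT => [|i _]; last first.
  by rewrite -expr2 sqr_ge0.
apply: contra u0; rewrite psumr_eq0 => [|i _]; last by rewrite -expr2 sqr_ge0.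
move=> /allP h; apply/eqP/rowP => i; rewrite mxE; apply/eqP.
by have := h i (mem_index_enum _); rewrite mulf_eq0 orbb.
Qed.

Lemma reflect_bisector a : a != 0 -> reflect a (dotv a a / 2) 0 = a.
Proof.
move=> a0; have h := lt0r_neq0 (dotv_gt0 a0).
rewrite /reflect dotv0l (_ : _ / _ = -1); last by field.
by rewrite scaleN1r opprK add0r.
Qed.

(* A reflection [s] in [Omega] is determined by [s 0], which may be any nonzero
   point. *)
Lemma OmegaE s : Omega s <->
  s 0 != 0 /\ s = reflect (s 0) (dotv (s 0) (s 0) / 2).
Proof.
split=> [[[u [c [u0 ->]]] s0]|[s0 ->]]; last first.
  split; first by exists (s 0), (dotv (s 0) (s 0) / 2).
  by rewrite reflect_bisector.
have uu := lt0r_neq0 (dotv_gt0 u0).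
split => //.
have E : reflect u c 0 = (2 * c / dotv u u) *: u.
  by rewrite /reflect dotv0l !sub0r mulrN mulNr scaleNr opprK.
have c0 : c != 0.
  by apply: contra s0 => /eqP c0; rewrite E c0 mulr0 mul0r scale0r.
rewrite E; set k := _ / _; apply/funext => x; rewrite /reflect.
have k0 : k != 0 by rewrite /k !mulf_neq0 ?invr_eq0 ?pnatr_eq0.
congr (_ - _); rewrite scalerA dotvZl ![dotv _ (k *: u)]dotvC !dotvZl.
rewrite (dotvC u x); congr (_ *: _).
have -> : c = k * dotv u u / 2.
  by rewrite /k divfK// mulrAC divff ?pnatr_eq0// mul1r.
have t0 : (2 : R) != 0 by rewrite pnatr_eq0.
by field; rewrite uu k0.
Qed.

Lemma Omega_reflect a : a != 0 -> Omega (reflect a (dotv a a / 2)) /\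
  reflect a (dotv a a / 2) 0 = a.
Proof.
move=> a0; suff E : reflect a (dotv a a / 2) 0 = a.
  by split => //; split; rewrite ?E//; exists a, (dotv a a / 2).
exact: reflect_bisector.
Qed.

Lemma mirrorE s : Omega s ->
  mirror s = [set x | dotv x (s 0) = dotv (s 0) (s 0) / 2].
Proof.
move=> /OmegaE[s0 sE]; have h := lt0r_neq0 (dotv_gt0 s0).
have sxE x : s x = reflect (s 0) (dotv (s 0) (s 0) / 2) x by rewrite -sE.
apply/seteqP; split => x /=; rewrite /mirror/= (sxE x) /reflect.
  move=> /eqP; rewrite -subr_eq0 addrAC subrr sub0r oppr_eq0 scaler_eq0.
  rewrite (negbTE s0) orbF !mulf_eq0 pnatr_eq0/= invr_eq0 (negbTE h) orbF.
  by rewrite subr_eq0 => /eqP.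
by move=> ->; rewrite subrr mulr0 mul0r scale0r subr0.
Qed.

Definition polarize s (f : 'rV[R]_d -> R) : 'rV[R]_d -> R := fun x =>
  if x \in mirror_pos s then Num.max (f x) (f (s x))
  else if x \in mirror_neg s then Num.min (f x) (f (s x))
  else f x.

(* Polarizes with respect to [s 0], then [s 1], ..., then [s n.-1]. *)
Fixpoint polarize_seq (s : nat -> 'rV[R]_d -> 'rV[R]_d) (n : nat)
    (f : 'rV[R]_d -> R) : 'rV[R]_d -> R :=
  if n is n'.+1 then polarize (s n') (polarize_seq s n' f) else f.

(* The open centered ball with the same measure as A (for A of finite measure).
   The radius of this ball is unique if 0 < d. *)
Definition symm_set (A : set 'rV[R]_d) : set 'rV[R]_d :=
  eball (xget 0 [set r | 0 <= r /\
                         lebesgue_rV R d (eball r) = lebesgue_rV R d A]).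

(* The levels are t > 0; the maximum with 0 gives the empty set of levels the
   supremum 0. The value at x = 0 is +oo if f is not essentially bounded. *)
Definition symm_fun (f : 'rV[R]_d -> R) (x : 'rV[R]_d) : \bar R :=
  maxe 0%E (ereal_sup
    [set t%:E | t in [set t | 0 < t /\ symm_set [set y | t < f y] x]]).

(* The law of [s 0] for the random reflections [s]. *)
Definition reflection_law (L : R) (B : set 'rV[R]_d) : \bar R :=
  (((2 * L)%:E * omega)^-1 *
   \int[lebesgue_rV R d]_(x in B `&` eball (2 * L))
     (enorm x ^- (d - 1))%:E)%E.

End euclid.

Arguments omega : clear implicits.
Arguments Omega : clear implicits.

Definition mutually_independent (R : realType) (dT dU : measure_display)
    (T : measurableType dT) (U : measurableType dU) (P : probability T R)
    (X : nat -> T -> U) : Prop :=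
  forall (J : seq nat) (B : nat -> set U),
    uniq J -> (forall i, measurable (B i)) ->
    P (\bigcap_(i in [set` J]) (X i @^-1` B i)) =
    (\prod_(i <- J) P (X i @^-1` B i))%E.

(* Main.v *)
(* Fix a level t and let A be the superlevel set {f > t} after some
   polarizations, B = {f^* > t} the centered ball of the same measure. Polarizing
   by s decreases m(A \ B) by at least the measure of the points x of A \ B with
   s x in B \ A. Under the given law, the mirror image of a point x of the ball
   B_L has a density on B_L bounded below by a constant k: along each line
   through 0, s 0 is uniformly distributed, and moving s 0 along this line
   translates the image of x. So one random polarization decreases the expected
   value e of m(A \ B) by at least k e^2, whence e <= 1/(k n) after n steps,
   uniformly in t. The L^1-distance is the integral of 2 m(A \ B) over t > 0.
   The levels t < S contribute at most 2 S/(k n), those above S at most twice the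
   integral of (f - S)^+ <= S^(1-p) f^p, and S = n^(1/p) balances the two. *)

From HB Require Import structures.
From mathcomp Require Import all_boot all_order all_algebra.
From mathcomp Require Import all_classical all_reals all_analysis.
From mathcomp Require Import measurable_realfun ess_sup_inf.
From mathcomp Require Import ring lra.
Import Order.TTheory GRing.Theory Num.Theory.
Import numFieldNormedType.Exports.
Require Import Defs.

Set Implicit Arguments.
Unset Strict Implicit.
Unset Printing Implicit Defensive.

Local Open Scope classical_set_scope.
Local Open Scope ring_scope.

(** * Invariance of Lebesgue measure on R^n *)

(** Lebesgue measure is built here as an iterated product, so translation and scaling pass from the
    line to all dimensions by induction. Reflections mix the coordinates; their invariance is
    deduced from translation invariance by comparing measures on a ball. The density |a|^-(d-1) is
    integrated in the chart a = t (1, s) of lines through 0 instead of polar coordinates, so that no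
    surface measure is computed. The constant k is the normalizing constant of the law times (2
    L)^-(d-1), a lower bound of the density at the displacements between points of B_L. The gain of
    one step is quadratic because A and B have equal measure: each x of A \ B is sent into B \ A
    with probability at least k m(B \ A) = k m(A \ B). This gain is known for each outcome of the
    earlier reflections, so its expectation is that of a square; a tangent line with a free
    parameter s bounds the square from below by an expression linear in the excess. For p = +oo the
    threshold S is the essential supremum, nothing lies above it, and the rate is 1/n. *)

Section measurability.
Context {R : realType} d (T : measurableType d).

Lemma measurable_inv_ge0 (f : T -> R) : (forall t, 0 <= f t) ->
  measurable_fun [set: T] f -> measurable_fun [set: T] (fun t => (f t)^-1).
Proof.
move=> f0 mf; rewrite (_ : (fun _ => _) = (fun x => x `^ (-1)) \o f).
  exact: measurableT_comp (measurable_powR _) mf.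
by apply/funext => t /=; rewrite powR_inv1.
Qed.

Context {n : nat}.
Implicit Types f g : T -> 'rV[R]_n.

Lemma measurable_coordT f i : measurable_fun [set: T] f ->
  measurable_fun [set: T] (fun t => f t ord0 i).
Proof. by move=> mf; exact: measurableT_comp (measurable_coord i) mf. Qed.

Lemma measurable_rVD f g : measurable_fun [set: T] f ->
  measurable_fun [set: T] g -> measurable_fun [set: T] (fun t => f t + g t).
Proof.
move=> mf mg; apply: measurable_fun_rV => i.
rewrite (_ : (fun _ => _) = (fun t => f t ord0 i + g t ord0 i)).
  by apply: measurable_funD; exact: measurable_coordT.
by apply/funext => t; rewrite mxE.
Qed.

Lemma measurable_rVZ (h : T -> R) f : measurable_fun [set: T] h ->
  measurable_fun [set: T] f -> measurable_fun [set: T] (fun t => h t *: f t).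
Proof.
move=> mh mf; apply: measurable_fun_rV => i.
rewrite (_ : (fun _ => _) = (fun t => h t * f t ord0 i)).
  by apply: measurable_funM => //; exact: measurable_coordT.
by apply/funext => t; rewrite mxE.
Qed.

Lemma measurable_rVN f : measurable_fun [set: T] f ->
  measurable_fun [set: T] (fun t => - f t).
Proof.
move=> mf; rewrite (_ : (fun _ => _) = (fun t => -1 *: f t)).
  exact: measurable_rVZ.
by apply/funext => t; rewrite scaleN1r.
Qed.

Lemma measurable_dotv f g : measurable_fun [set: T] f ->
  measurable_fun [set: T] g -> measurable_fun [set: T] (fun t => dotv (f t) (g t)).
Proof.
move=> mf mg; rewrite /dotv; apply: measurable_sum => i.
by apply: measurable_funM; exact: measurable_coordT.
Qed.

Lemma dotvv_ge0 (x : 'rV[R]_n) : 0 <= dotv x x.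
Proof. by apply: sumr_ge0 => i _; rewrite -expr2 sqr_ge0. Qed.

Lemma measurable_enorm f : measurable_fun [set: T] f ->
  measurable_fun [set: T] (fun t => enorm (f t)).
Proof.
move=> mf; rewrite (_ : (fun _ => _) =
    (fun x => x `^ 2^-1) \o (fun t => dotv (f t) (f t))).
  exact: measurableT_comp (measurable_powR _) (measurable_dotv mf mf).
by apply/funext => t /=; rewrite powR12_sqrt// dotvv_ge0.
Qed.

Lemma measurable_reflect f g (h : T -> R) : measurable_fun [set: T] f ->
  measurable_fun [set: T] g -> measurable_fun [set: T] h ->
  measurable_fun [set: T] (fun t => reflect (f t) (h t) (g t)).
Proof.
move=> mf mg mh; apply: measurable_rVD => //; apply: measurable_rVN.
apply: measurable_rVZ => //; apply: measurable_funM.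
  apply: measurable_funM => //; apply: measurable_funB => //.
  exact: measurable_dotv.
apply: measurable_inv_ge0 => [t|]; first exact: dotvv_ge0.
exact: measurable_dotv.
Qed.

End measurability.

Section lebesgue_line.
Context {R : realType}.
Local Notation mu := (@lebesgue_measure R).
Local Open Scope ereal_scope.

(** Lebesgue measure is determined by the lengths of half-open intervals, which a shift preserves;
    the equality of measures passes to integrals by pushforward. *)
Lemma integral_lebesgue_translation (f : measurableTypeR R -> \bar R) (a : R) :
  measurable_fun [set: measurableTypeR R] f -> (forall x, 0 <= f x) ->
  \int[mu]_x f (x + a)%R = \int[mu]_x f x.
Proof.
move=> mf f0; pose phi : measurableTypeR R -> measurableTypeR R := fun x => (x + a)%R.
have mphi : measurable_fun setT phi by exact: measurable_funD.
rewrite -[LHS]/(\int[mu]_(x in phi @^-1` setT) (f \o phi) x).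
rewrite -ge0_integral_pushforward//.
apply: eq_measure_integral => //= A mA _; apply/esym/lebesgue_measure_unique => //.
move=> _ [[u v]] _ <- /=; rewrite /pushforward.
rewrite (_ : _ @^-1` _ = [set` `]u - a, v - a]]%R%classic); last first.
  by apply/seteqP; split => x /=; rewrite !in_itv/= /phi ltrBlDr lerBrDr.
rewrite !lebesgue_measure_itv/= !lte_fin ltrD2r.
by case: ifP => // _; congr EFin; ring.
Qed.

Let integral_lebesgue_scale_gt0 (f : measurableTypeR R -> \bar R) (c : R) :
  (0 < c)%R -> measurable_fun [set: measurableTypeR R] f -> (forall x, 0 <= f x) ->
  c%:E * \int[mu]_x f (c * x)%R = \int[mu]_x f x.
Proof.
move=> c0 mf f0; pose phi : measurableTypeR R -> measurableTypeR R := fun x => (c * x)%R.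
have mphi : measurable_fun setT phi by exact: measurable_funM.
rewrite -[X in _ * X]/(\int[mu]_(x in phi @^-1` setT) (f \o phi) x).
rewrite -ge0_integral_pushforward//.
pose c' := NngNum (ltW c0).
rewrite -[c]/(c'%:num) -ge0_integral_mscale//.
apply: eq_measure_integral => //= A mA _; apply/esym/lebesgue_measure_unique => //.
move=> _ [[u v]] _ <- /=; rewrite /mscale /= /pushforward.
rewrite (_ : _ @^-1` _ = [set` `]u / c, v / c]]%R%classic); last first.
  by apply/seteqP; split => x /=; rewrite !in_itv/= /phi ltr_pdivrMr// ler_pdivlMr// mulrC.
rewrite !lebesgue_measure_itv/= !lte_fin ltr_pM2r ?invr_gt0//.
case: ifP => // _; rewrite ?mule0// -EFinD -EFinM; congr EFin; field.
by rewrite gt_eqF.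
Qed.

Lemma integral_lebesgue_scale (f : measurableTypeR R -> \bar R) (c : R) :
  (c != 0)%R -> measurable_fun [set: measurableTypeR R] f -> (forall x, 0 <= f x) ->
  `|c|%:E * \int[mu]_x f (c * x)%R = \int[mu]_x f x.
Proof.
rewrite neq_lt => /orP[c0|c0] mf f0; last first.
  by rewrite gtr0_norm//; exact: integral_lebesgue_scale_gt0.
have N0 : (0 < - c)%R by rewrite oppr_gt0.
have mN : measurable_fun [set: measurableTypeR R] (-%R : _ -> measurableTypeR R).
  exact: oppr_measurable.
have mfN : measurable_fun [set: measurableTypeR R] (fun x => f (- x)%R).
  exact: measurableT_comp mf mN.
transitivity (\int[mu]_x f (- x)%R).
  rewrite ltr0_norm// -(@integral_lebesgue_scale_gt0 (fun x => f (- x)%R) (- c)%R)//.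
  by congr (_ * _); apply: eq_integral => x _; rewrite mulNr opprK.
rewrite -[LHS]/(\int[mu]_(x in (-%R : _ -> measurableTypeR R) @^-1` setT)
   (f \o (-%R : _ -> measurableTypeR R)) x).
rewrite -ge0_integral_pushforward//.
by apply: eq_measure_integral => //= A mA _; exact: lebesgue_measureN.
Qed.

End lebesgue_line.

Section lebesgue_rV_integral.
Context {R : realType}.
Local Notation mu := (@lebesgue_measure R).
Local Notation m n := (lebesgue_rV R n).
Local Open Scope ereal_scope.

Let measurable_rV_consT n (f : 'rV[R]_n.+1 -> \bar R) :
  measurable_fun [set: 'rV[R]_n.+1] f ->
  measurable_fun [set: measurableTypeR R * 'rV[R]_n] (f \o @rV_cons R n).
Proof. by move=> mf; exact: measurableT_comp mf (@measurable_rV_cons R n). Qed.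

(** Tonelli's theorem for the recursive definition of the measure: it carries properties of the line
    to all dimensions. *)
Lemma integral_lebesgue_rVS n (f : 'rV[R]_n.+1 -> \bar R) :
  measurable_fun [set: 'rV[R]_n.+1] f -> (forall x, 0 <= f x) ->
  \int[m n.+1]_x f x = \int[mu]_a \int[m n]_w f (rV_cons (a, w)).
Proof.
move=> mf f0.
rewrite [LHS](@ge0_integral_pushforward _ _ _ _ _ _ (@measurable_rV_cons R n)
  (mu \x m n)%E setT f)// fubini_tonelli1//; last 2 first.
  exact: measurable_rV_consT.
  by move=> x /=.
Qed.


Lemma measurable_integral_rV_cons n (f : 'rV[R]_n.+1 -> \bar R) :
  measurable_fun [set: 'rV[R]_n.+1] f -> (forall x, 0 <= f x) ->
  measurable_fun [set: measurableTypeR R]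
    (fun a => \int[m n]_w f (rV_cons (a, w))).
Proof.
move=> mf f0.
by apply: (measurable_fun_fubini_tonelli_F (f \o @rV_cons R n)
  (measurable_rV_consT mf)) => z /=.
Qed.

Lemma measurable_comp_rV_cons n (f : 'rV[R]_n.+1 -> \bar R) (a : R) :
  measurable_fun [set: 'rV[R]_n.+1] f ->
  measurable_fun [set: 'rV[R]_n] (fun w => f (rV_cons (a, w))).
Proof.
move=> mf; apply: (measurableT_comp (measurable_rV_consT mf)).
exact: (@pair1_measurable _ _ (measurableTypeR R) _ a).
Qed.

Lemma integral_rV_translation n (f : 'rV[R]_n -> \bar R) (v : 'rV[R]_n) :
  measurable_fun [set: 'rV[R]_n] f -> (forall x, 0 <= f x) ->
  \int[m n]_x f (x + v)%R = \int[m n]_x f x.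
Proof.
elim: n f v => [|n IH] f v mf f0.
  by apply: eq_integral => x _; congr f; apply/rowP => -[].
have mfv : measurable_fun [set: 'rV[R]_n.+1] (fun x => f (x + v)%R).
  by apply: (measurableT_comp mf); apply: measurable_rVD => //; exact: measurable_cst.
rewrite (integral_lebesgue_rVS mfv (fun=> f0 _)) (integral_lebesgue_rVS mf f0).
pose v' := (rV_uncons v).2.
rewrite -(@integral_lebesgue_translation _ (fun a => \int[m n]_w f (rV_cons (a, w)))
  (v ord0 ord0)); last 2 first.
- exact: measurable_integral_rV_cons.
- by move=> a; exact: integral_ge0.
apply: eq_integral => a _; rewrite -[RHS](IH _ v')//; last exact: measurable_comp_rV_cons.
apply: eq_integral => w _; congr f; apply/rowP => i; rewrite !mxE.
by case: (unliftP ord0 i) => [j ->|->]; rewrite ?mxE.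
Qed.

Lemma integral_rV_scale n (f : 'rV[R]_n -> \bar R) (c : R) : (c != 0)%R ->
  measurable_fun [set: 'rV[R]_n] f -> (forall x, 0 <= f x) ->
  (`|c| ^+ n)%:E * \int[m n]_x f (c *: x)%R = \int[m n]_x f x.
Proof.
move=> c0; elim: n f => [|n IH] f mf f0.
  by rewrite expr0 mul1e; apply: eq_integral => x _; congr f; apply/rowP => -[].
have mfc : measurable_fun [set: 'rV[R]_n.+1] (fun x => f (c *: x)%R).
  by apply: (measurableT_comp mf); apply: measurable_rVZ => //; exact: measurable_cst.
have E : forall a, (`|c| ^+ n)%:E * \int[m n]_w f (c *: rV_cons (a, w))%R =
    \int[m n]_w f (rV_cons ((c * a)%R, w)).
  move=> a; rewrite -[RHS]IH//; last exact: measurable_comp_rV_cons.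
  congr (_ * _); apply: eq_integral => w _; congr f; apply/rowP => i; rewrite !mxE.
  by case: (unlift ord0 i) => [j|] /=; rewrite ?mxE.
rewrite (integral_lebesgue_rVS mfc (fun=> f0 _)) (integral_lebesgue_rVS mf f0).
rewrite -(@integral_lebesgue_scale _ (fun a => \int[m n]_w f (rV_cons (a, w))) c c0);
  last 2 first.
- exact: measurable_integral_rV_cons.
- by move=> a; exact: integral_ge0.
rewrite exprS EFinM -muleA; congr (_ * _).
rewrite -ge0_integralZl//; last 2 first.
- by apply: (measurable_integral_rV_cons mfc).
- by move=> a _; exact: integral_ge0.
by apply: eq_integral => a _; rewrite E.
Qed.

Lemma rV_measure_indic n (A : set 'rV[R]_n) : measurable A ->
  m n A = \int[m n]_x (\1_A x)%:E.
Proof. by move=> mA; rewrite integral_indic// setIT. Qed.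

End lebesgue_rV_integral.

(** * Euclidean norm and the algebra of reflections *)

Section reflections.
Context {R : realType} {n : nat}.
Implicit Types x y a u v : 'rV[R]_n.

Lemma enorm_ge0 x : 0 <= enorm x. Proof. exact: sqrtr_ge0. Qed.

Lemma enorm_sqr x : enorm x ^+ 2 = dotv x x.
Proof. by rewrite sqr_sqrtr// dotvv_ge0. Qed.

Lemma dotvDr x y u : dotv u (x + y) = dotv u x + dotv u y.
Proof. by rewrite !(dotvC u) dotvDl. Qed.

Lemma dotvZr c x u : dotv u (c *: x) = c * dotv u x.
Proof. by rewrite !(dotvC u) dotvZl. Qed.

Lemma dotvNl x u : dotv (- x) u = - dotv x u.
Proof. by rewrite -scaleN1r dotvZl mulN1r. Qed.

Lemma dotvNr x u : dotv u (- x) = - dotv u x.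
Proof. by rewrite !(dotvC u) dotvNl. Qed.

Definition dotvE := (dotvDl, dotvDr, dotvNl, dotvNr, dotvZl, dotvZr).

Lemma dotvv_eq0 x : (dotv x x == 0) = (x == 0).
Proof.
apply/idP/idP => [|/eqP->]; last by rewrite dotv0l.
by apply: contraLR => /dotv_gt0/lt0r_neq0.
Qed.

Lemma enormN x : enorm (- x) = enorm x.
Proof. by rewrite /enorm !dotvE opprK. Qed.

Lemma enormZ c x : enorm (c *: x) = `|c| * enorm x.
Proof.
by rewrite /enorm !dotvE mulrA sqrtrM -?expr2 ?sqr_ge0// sqrtr_sqr.
Qed.

Lemma enorm0 : enorm (0 : 'rV[R]_n) = 0.
Proof. by rewrite /enorm dotv0l sqrtr0. Qed.

Lemma enorm_eq0 x : (enorm x == 0) = (x == 0).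
Proof. by rewrite -dotvv_eq0 -enorm_sqr sqrf_eq0. Qed.

Lemma enorm_ltE x y : (enorm x < enorm y) = (dotv x x < dotv y y).
Proof. by rewrite -!enorm_sqr ltr_pXn2r// nnegrE enorm_ge0. Qed.

(** The squared norm of [enorm y *: x - enorm x *: y] is 2 |x| |y| (|x| |y| - x.y), and it is
    nonnegative. *)
Lemma cauchy_schwarz x y : dotv x y <= enorm x * enorm y.
Proof.
have [->|x0] := eqVneq x 0; first by rewrite dotv0l enorm0 mul0r.
have [->|y0] := eqVneq y 0; first by rewrite dotvC dotv0l enorm0 mulr0.
have nx : 0 < enorm x by rewrite lt_def enorm_eq0 x0 enorm_ge0.
have ny : 0 < enorm y by rewrite lt_def enorm_eq0 y0 enorm_ge0.
have := dotvv_ge0 (enorm y *: x - enorm x *: y).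
rewrite !dotvE (dotvC y x) -!enorm_sqr => h.
have : 0 <= 2 * (enorm x * enorm y) * (enorm x * enorm y - dotv x y).
  by apply: le_trans h _; rewrite le_eqVlt; apply/orP; left; apply/eqP; ring.
by rewrite pmulr_rge0 ?subr_ge0// mulr_gt0// mulr_gt0.
Qed.

Lemma ler_enormD x y : enorm (x + y) <= enorm x + enorm y.
Proof.
rewrite -(@ler_pXn2r _ 2)// ?nnegrE ?addr_ge0 ?enorm_ge0//.
rewrite enorm_sqr !dotvE sqrrD -!enorm_sqr (dotvC y x).
have := cauchy_schwarz x y; lra.
Qed.

Lemma measurable_eball r : measurable (@eball R n r).
Proof.
rewrite -[X in measurable X]setTI.
rewrite (_ : @eball R n r = (@enorm R n) @^-1` [set` `]-oo, r[]); last first.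
  by apply/seteqP; split => x /=; rewrite in_itv.
by apply: measurable_enorm; [exact: measurable_id| |exact: measurable_itv].
Qed.

Lemma reflectK u c : involutive (@Defs.reflect R n u c).
Proof.
move=> x; have [->|u0] := eqVneq u 0; first by rewrite /reflect !scaler0 !subr0.
have h : dotv u u != 0 by rewrite dotvv_eq0.
rewrite /reflect !dotvE -addrA -opprD -scalerDl [X in X *: u](_ : _ = 0) ?scale0r ?subr0//.
by field.
Qed.

End reflections.

(** * Measure of balls and invariance under reflections *)

Section rV_measure.
Context {R : realType}.
Local Notation m n := (lebesgue_rV R n).

Lemma measurable_preimage_rV d (T : measurableType d) n (f : T -> 'rV[R]_n) A :
  measurable_fun [set: T] f -> measurable A -> measurable (f @^-1` A).
Proof. by move=> mf mA; rewrite -[X in measurable X]setTI; exact: mf. Qed.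

Lemma measurable_indic_comp d d' (T : measurableType d) (U : measurableType d')
    (f : T -> U) (A : set U) :
  measurable_fun [set: T] f -> measurable A ->
  measurable_fun [set: T] (fun t => \1_A (f t) : R).
Proof.
by move=> mf mA; apply: measurableT_comp mf; exact: measurable_indic.
Qed.

(** Cubes are boxes, whose measure is known; a ball is then enclosed in one cube and contains
    another. *)
Lemma cube_measure n (e : R) : 0 < e ->
  let box := [set x : 'rV[R]_n | forall i, `|x ord0 i| < e] in
  measurable box /\ m n box = ((e + e) ^+ n)%:E.
Proof.
move=> e0 box; pose I : set (measurableTypeR R) := [set` `]-e, e[%R].
have mI : measurable I by exact: measurable_itv.
have boxE : box = [set x | forall i, I (x ord0 i)].
  by apply/seteqP; split => x /= H i; have := H i; rewrite /I/= in_itv/= ltr_norml.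
split.
  rewrite boxE [X in measurable X](_ : _ = \bigcap_(i in [set: 'I_n])
      ((fun x : 'rV[R]_n => x ord0 i) @^-1` I)).
    apply: fin_bigcap_measurable; first exact: finite_finset.
    by move=> i _; rewrite -[X in measurable X]setTI; exact: measurable_coord.
  by apply/seteqP; split => x /= H i; have := H i; try exact.
rewrite boxE (@lebesgue_rV_box R n (fun=> I))//.
rewrite lebesgue_measure_itv/= lte_fin gtrN// -EFinD opprK prodEFin.
by rewrite prodr_const card_ord.
Qed.

Lemma eball_measure_fin n (r : R) : (m n (eball r) < +oo)%E.
Proof.
have e0 : 0 < `|r| + 1 by rewrite ltr_pwDr.
have [mbox boxE] := cube_measure n e0.
apply: (@le_lt_trans _ _ (m n [set x | forall i, `|x ord0 i| < `|r| + 1])).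
  apply: le_measure; rewrite ?inE//; first exact: measurable_eball.
  move=> x; rewrite /eball/= => xr i; apply: (@le_lt_trans _ _ (enorm x)).
    rewrite -(@ler_pXn2r _ 2)// ?nnegrE ?enorm_ge0//.
    rewrite enorm_sqr real_normK ?num_real// /dotv (bigD1 i)//= expr2 lerDl.
    by apply: sumr_ge0 => j _; rewrite -expr2 sqr_ge0.
  by rewrite (lt_le_trans xr)// (le_trans (ler_norm _))// lerDl.
by rewrite boxE ltry.
Qed.

Lemma eball_measure_gt0 n (r : R) : 0 < r -> (0 < m n (eball r))%E.
Proof.
(* The cube fits in the ball because n (r / (n + 1))^2 < r^2; the successor also covers n = 0. *)
move=> r0; pose e := r / n.+1%:R.
have e0 : 0 < e by rewrite divr_gt0.
have [mbox boxE] := cube_measure n e0.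
apply: (@lt_le_trans _ _ (m n [set x | forall i, `|x ord0 i| < e])).
  by rewrite boxE lte_fin exprn_gt0// addr_gt0.
apply: le_measure; rewrite ?inE//; first exact: measurable_eball.
move=> x xe; rewrite /eball/= -(@ltr_pXn2r _ 2)// ?nnegrE ?enorm_ge0 ?(ltW r0)//.
rewrite enorm_sqr; apply: (@le_lt_trans _ _ (\sum_(i < n) e ^+ 2)).
  apply: ler_sum => i _; rewrite -expr2 -[X in X <= _]real_normK ?num_real//.
  by rewrite ler_pXn2r// ?nnegrE// ltW// xe.
rewrite sumr_const card_ord -[X in X < _]mulr_natl /e expr_div_n mulrA.
rewrite ltr_pdivrMr ?exprn_gt0//.
rewrite [X in X < _]mulrC ltr_pM2l ?exprn_gt0// -natrX ltr_nat.
by rewrite (leq_trans (ltnSn n))// leq_pmulr.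
Qed.

Lemma in_eball n r (x : 'rV[R]_n) : (x \in eball r) = (enorm x < r).
Proof. by apply/idP/idP; rewrite inE. Qed.

Section isometry.
Context {n : nat} (s : 'rV[R]_n -> 'rV[R]_n).
Hypothesis sm : measurable_fun [set: 'rV[R]_n] s.
Hypothesis sD : {morph s : x y / x + y}.
Hypothesis sK : involutive s.
Hypothesis sN : forall x, enorm (s x) = enorm x.
Local Open Scope ereal_scope.
Local Notation mn := (m n).

Let integral_indicM (A B : set 'rV[R]_n) : measurable A -> measurable B ->
  \int[mn]_x \int[mn]_y (\1_A x * \1_B y)%:E = mn A * mn B.
Proof.
move=> mA mB.
transitivity (\int[mn]_x ((\1_A x)%:E * mn B)).
  apply: eq_integral => x _; under eq_integral do rewrite EFinM.
  rewrite ge0_integralZl//; last by apply/measurable_EFinP; exact: measurable_indic.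
  by rewrite integral_indic// setIT.
rewrite ge0_integralZr//; last by apply/measurable_EFinP; exact: measurable_indic.
by rewrite integral_indic// setIT.
Qed.

(* Both sides are the integral of 1_A(x) 1_B(s y) for the unit ball B, up to
   translations in x and y: the pushforward of the measure by s is translation
   invariant, hence a multiple of the measure, and B fixes the multiple. *)
Lemma isometry_measure (A : set 'rV[R]_n) : measurable A ->
  mn (s @^-1` A) = mn A.
Proof.
move=> mA; pose B := @eball R n 1.
have mB : measurable B by exact: measurable_eball.
have msA : measurable (s @^-1` A) by exact: measurable_preimage_rV.
have Bs y : \1_B (s y) = \1_B y :> R by rewrite !indicE !in_eball sN.
have BN y : \1_B (- y)%R = \1_B y :> R by rewrite !indicE !in_eball enormN.
have sNN y : s (- y) = (- s y)%R.
  apply/eqP; rewrite -subr_eq0 opprK -sD addrC subrr.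
  by apply/eqP; apply: (@addrI _ (s 0%R)); rewrite -sD !addr0.
have mX : measurable_fun setT (fun z : 'rV[R]_n * 'rV[R]_n => z.1) by exact: measurable_fst.
have mY : measurable_fun setT (fun z : 'rV[R]_n * 'rV[R]_n => s z.2).
  by apply: measurableT_comp => //; exact: measurable_snd.
have mF : measurable_fun setT (fun z : 'rV[R]_n * 'rV[R]_n =>
    (\1_A z.1 * \1_B (s z.2 - z.1)%R : R)%:E).
  apply/measurable_EFinP/measurable_funM; first exact: measurable_indic_comp.
  apply: measurable_indic_comp => //; apply: measurable_rVD => //.
  exact: measurable_rVN.
have mG : measurable_fun setT (fun z : 'rV[R]_n * 'rV[R]_n =>
    (\1_A (z.1 + s z.2)%R * \1_B (- z.1)%R : R)%:E).
  apply/measurable_EFinP/measurable_funM; apply: measurable_indic_comp => //.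
    exact: measurable_rVD.
  exact: measurable_rVN.
have B0 : mn B != 0 by rewrite gt_eqF// eball_measure_gt0.
have Bf : mn B \is a fin_num by rewrite ge0_fin_numE// eball_measure_fin.
suff : mn A * mn B = mn (s @^-1` A) * mn B.
  rewrite -(fineK Bf) => E; have f0 : fine (mn B) != 0%R.
    by rewrite fine_eq0.
  move: (congr1 (fun z => z * (fine (mn B))^-1%:E) E).
  by rewrite -!muleA -!EFinM mulfV// !mule1.
(* Shift y by - s x: as [s] is an additive involution, s (y - s x) = s y - x, and B is invariant
   under [s]. *)
transitivity (\int[mn]_x \int[mn]_y (\1_A x * \1_B (s y - x)%R)%:E).
  rewrite -(integral_indicM mA mB); apply: eq_integral => x _.
  rewrite -(@integral_rV_translation _ _ (fun y => (\1_A x * \1_B y)%:E) (- s x)%R).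
  - apply: eq_integral => y _; rewrite -Bs sD; congr (_ * \1_B _)%:E.
    by rewrite sNN sK.
  - by apply/measurable_EFinP/measurable_funM.
  - by move=> y; rewrite lee_fin mulr_ge0.
rewrite (fubini_tonelli _ mF); last by move=> z; rewrite lee_fin mulr_ge0.
(* After the exchange of integrals, the shift of x by s y turns s y - x into - x; a last shift of y
   by s x then separates the variables. *)
transitivity (\int[mn]_y \int[mn]_x (\1_A (x + s y)%R * \1_B (- x)%R)%:E).
  apply: eq_integral => y _.
  rewrite -(@integral_rV_translation _ _ (fun x => (\1_A x * \1_B (s y - x)%R)%:E) (s y)).
  - by apply: eq_integral => x _; rewrite opprD addrCA subrr addr0.
  - apply/measurable_EFinP/measurable_funM => //; apply: measurable_indic_comp => //.
    apply: measurable_rVD; first exact: measurable_cst.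
    by apply: measurable_rVN; exact: measurable_id.
  - by move=> x; rewrite lee_fin mulr_ge0.
rewrite -(fubini_tonelli _ mG); last by move=> z; rewrite lee_fin mulr_ge0.
rewrite muleC -(integral_indicM mB msA); apply: eq_integral => x _.
rewrite -(@integral_rV_translation _ _ (fun y => (\1_B x * \1_(s @^-1` A) y)%:E) (s x)).
- apply: eq_integral => y _; rewrite BN mulrC; congr (_ * _)%:E.
  by rewrite -[\1_(_ @^-1` _) _]/(\1_A (s (y + s x)%R)) sD sK addrC.
- by apply/measurable_EFinP/measurable_funM.
- by move=> y; rewrite lee_fin mulr_ge0.
Qed.

End isometry.

Lemma measurable_reflectT n (u : 'rV[R]_n) c :
  measurable_fun [set: 'rV[R]_n] (Defs.reflect u c).
Proof.
apply: measurable_reflect; [exact: measurable_cst|exact: measurable_id|].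
exact: measurable_cst.
Qed.

(** An affine reflection is the linear one [reflect u 0] followed by the translation by [v]; the
    linear one is covered by [isometry_measure]. *)
Lemma reflect_measure n (u : 'rV[R]_n) c (A : set 'rV[R]_n) : measurable A ->
  m n (Defs.reflect u c @^-1` A) = m n A.
Proof.
move=> mA; pose v := ((2 * c / dotv u u) *: u)%R.
have E x : Defs.reflect u c x = Defs.reflect u 0 x + v.
  rewrite /reflect /v -addrA -scaleNr -[X in _ = _ + (X + _)]scaleNr -scalerDl.
  congr (_ + _ *: _).
  by rewrite subr0 mulrBr mulrBl opprB addrC.
have mAv : measurable ((fun x => x + v) @^-1` A).
  apply: measurable_preimage_rV => //; apply: measurable_rVD; first exact: measurable_id.
  exact: measurable_cst.
rewrite (_ : _ @^-1` A = Defs.reflect u 0 @^-1` ((fun x => x + v) @^-1` A)); last first.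
  by apply/seteqP; split => x /=; rewrite E.
rewrite isometry_measure//.
- rewrite !rV_measure_indic// -[RHS](@integral_rV_translation _ _ _ v)//.
  by apply/measurable_EFinP; exact: measurable_indic.
- exact: measurable_reflectT.
- move=> x y; rewrite /reflect !dotvE !subr0 addrACA; congr (_ + _).
  by rewrite -opprD -scalerDl mulrDr mulrDl.
- exact: reflectK.
- move=> x; rewrite /enorm; congr Num.sqrt.
  have [->|u0] := eqVneq u 0; first by rewrite /reflect !scaler0 !subr0.
  have h : dotv u u != 0 by rewrite dotvv_eq0.
  by rewrite /reflect !dotvE (dotvC u x); field.
Qed.

Lemma integral_reflect n (u : 'rV[R]_n) c (f : 'rV[R]_n -> \bar R) :
  measurable_fun [set: 'rV[R]_n] f -> (forall x, 0 <= f x)%E ->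
  (\int[m n]_x f (Defs.reflect u c x) = \int[m n]_x f x)%E.
Proof.
move=> mf f0.
rewrite -[LHS]/(\int[m n]_(x in Defs.reflect u c @^-1` setT) (f \o Defs.reflect u c) x)%E.
have ms := measurable_reflectT u c.
rewrite -ge0_integral_pushforward//.
by apply: eq_measure_integral => //= A mA _; exact: reflect_measure.
Qed.

End rV_measure.
(** * The law of the mirror image of a point *)

Section chart.
Context {R : realType} {n : nat}.
Local Notation mu := (@lebesgue_measure R).
Local Notation m n := (lebesgue_rV R n).
Local Open Scope ereal_scope.

Lemma integral_indicE d (T : measurableType d) (nu : {measure set T -> \bar R})
    (A : set T) (f : T -> \bar R) :
  \int[nu]_(x in A) f x = \int[nu]_x ((\1_A x)%:E * f x).
Proof.
rewrite integral_mkcond; apply: eq_integral => x _.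
by rewrite patchE indicE; case: ifP => _; rewrite ?mul1e ?mul0e.
Qed.

(** The direction (1, s) represents a line through 0; only the lines in the hyperplane of vanishing
    first coordinate, a null set, are missed. *)
Let e (s : 'rV[R]_n) : 'rV[R]_n.+1 := rV_cons (1%R, s).

Let dotv_e_gt0 s : (0 < dotv (e s) (e s))%R.
Proof.
apply: dotv_gt0; apply/eqP => /rowP/(_ ord0)/eqP.
by rewrite !mxE unlift_none oner_eq0.
Qed.

Let enorm_e_gt0 s : (0 < enorm (e s))%R.
Proof. by rewrite sqrtr_gt0. Qed.

Let measurable_e d (T : measurableType d) (f : T -> 'rV[R]_n) :
  measurable_fun [set: T] f -> measurable_fun [set: T] (fun t => e (f t)).
Proof.
move=> mf; have mp : measurable_fun [set: T] (fun t => (1%R : measurableTypeR R, f t)).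
  by apply/measurable_fun_pairP; split => //=; exact: measurable_cst.
exact: measurableT_comp (@measurable_rV_cons R n) mp.
Qed.

Let measurable_w d (T : measurableType d) (f : T -> 'rV[R]_n.+1) :
  measurable_fun [set: T] f ->
  measurable_fun [set: T] (fun t => (enorm (f t) ^- n)%:E).
Proof.
move=> mf; apply/measurable_EFinP; apply: measurable_inv_ge0 => [t|].
  by rewrite exprn_ge0// enorm_ge0.
by apply: measurable_funX; exact: measurable_enorm.
Qed.

(* Projective polar coordinates a = t (1, s): the Jacobian |t|^n cancels the
   radial part of the density |a|^-n. *)
Lemma integral_chart (F : 'rV[R]_n.+1 -> \bar R) :
  measurable_fun [set: 'rV[R]_n.+1] F -> (forall x, 0 <= F x) ->
  \int[m n.+1]_a (F a * (enorm a ^- n)%:E) =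
  \int[m n]_s ((enorm (e s) ^- n)%:E * \int[mu]_t F (t *: e s)%R).
Proof.
move=> mF F0.
have w0 k (a : 'rV[R]_k) i : 0 <= (enorm a ^- i)%:E.
  by rewrite lee_fin invr_ge0 exprn_ge0// enorm_ge0.
have mFw : measurable_fun [set: 'rV[R]_n.+1] (fun a => F a * (enorm a ^- n)%:E).
  by apply: emeasurable_funM => //; apply: measurable_w; exact: measurable_id.
have Fw0 a : 0 <= F a * (enorm a ^- n)%:E by rewrite mule_ge0.
have mte : measurable_fun setT (fun z : measurableTypeR R * 'rV[R]_n => (z.1 *: e z.2)%R).
  apply: measurable_rVZ; first exact: measurable_fst.
  by apply: measurable_e; exact: measurable_snd.
pose G (z : measurableTypeR R * 'rV[R]_n) := (enorm (e z.2) ^- n)%:E * F (z.1 *: e z.2)%R.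
have mG : measurable_fun setT G.
  apply: emeasurable_funM; last exact: measurableT_comp mF mte.
  by apply: measurable_w; apply: measurable_e; exact: measurable_snd.
have G0 z : 0 <= G z by rewrite mule_ge0.
transitivity (\int[mu]_t \int[m n]_s G (t, s)); last first.
  rewrite (fubini_tonelli G mG G0); apply: eq_integral => s _; rewrite /G /=.
  rewrite ge0_integralZl//; apply: (measurableT_comp mF).
  by apply: measurable_rVZ; [exact: measurable_id|exact: measurable_cst].
rewrite (integral_lebesgue_rVS mFw Fw0); apply: ge0_ae_eq_integral => //.
- exact: (measurable_integral_rV_cons mFw).
- exact: (measurable_fun_fubini_tonelli_F G mG).
- by move=> t _; exact: integral_ge0.
- by move=> t _; exact: integral_ge0.
(* For a given first coordinate t the others are substituted as t s, which needs t != 0; hence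
   equality only almost everywhere. *)
exists [set 0%R]; split => //; first exact: lebesgue_measure_set1.
move=> t /= /not_implyP[_ h]; apply: contra_notP h => /eqP t0.
have mFwt := measurable_comp_rV_cons t mFw.
rewrite -(integral_rV_scale t0 mFwt (fun=> Fw0 _)) -ge0_integralZl//; last first.
  apply: (measurableT_comp mFwt).
  by apply: measurable_rVZ; [exact: measurable_cst|exact: measurable_id].
apply: eq_integral => s _; rewrite /G /=.
have -> : rV_cons (t, t *: s)%R = (t *: e s)%R.
  apply/rowP => i; rewrite !mxE.
  by case: (unlift ord0 i) => [j|] /=; rewrite ?mxE ?mulr1.
rewrite muleCA muleC; congr (_ * _).
rewrite -EFinM enormZ exprMn invfM mulrA divff ?mul1r//.
by rewrite expf_neq0// normr_eq0.
Qed.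

(* The reflection exchanging 0 and a; it is the identity for a = 0. *)
Definition bisect k (a x : 'rV[R]_k) := Defs.reflect a (dotv a a / 2) x.

Let bisect_chart (t : R) s (x : 'rV[R]_n.+1) : (t != 0)%R ->
  bisect (t *: e s) x = (x + (t - 2 * dotv x (e s) / dotv (e s) (e s)) *: e s)%R.
Proof.
move=> t0; have e0 := lt0r_neq0 (dotv_e_gt0 s).
rewrite /bisect /reflect -scaleNr scalerA !dotvE; congr (_ + _ *: _)%R.
by field; rewrite t0 e0.
Qed.

Lemma measurable_bisect k d (T : measurableType d) (f g : T -> 'rV[R]_k) :
  measurable_fun [set: T] f -> measurable_fun [set: T] g ->
  measurable_fun [set: T] (fun t => bisect (f t) (g t)).
Proof.
move=> mf mg; apply: measurable_reflect => //.
by apply: measurable_funM; [exact: measurable_dotv|exact: measurable_cst].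
Qed.

(* For fixed s, the point bisect (t (1, s)) x moves on the line through x with
   direction (1, s), and its coordinate on this line is t up to a translation. *)
Lemma integral_bisect_ge (L : R) (x : 'rV[R]_n.+1) (V : set 'rV[R]_n.+1) :
  measurable V -> V `<=` eball L -> (enorm x < L)%R ->
  (forall y, V y -> enorm y != enorm x) ->
  ((2 * L) ^- n)%:E * m n.+1 V <=
  \int[m n.+1]_(a in [set a | V (bisect a x)] `&` eball (2 * L)) (enorm a ^- n)%:E.
Proof.
move=> mV VL xL Vx; set S := _ `&` _.
have mS : measurable S.
  apply: measurableI; last exact: measurable_eball.
  apply: (@measurable_preimage_rV _ _ _ _ (fun a => bisect a x)) => //.
  by apply: measurable_bisect; [exact: measurable_id|exact: measurable_cst].
have m1 (A : set 'rV[R]_n.+1) : measurable A ->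
    measurable_fun setT (fun z => (\1_A z : R)%:E).
  by move=> mA; apply/measurable_EFinP; exact: measurable_indic.
have i0 (A : set 'rV[R]_n.+1) z : 0 <= (\1_A z : R)%:E by rewrite lee_fin.
rewrite integral_indicE (integral_chart (m1 _ mS) (i0 _)).
pose U := [set z | V (x + z)%R].
have mU : measurable U.
  apply: (@measurable_preimage_rV _ _ _ _ (fun z => x + z)%R) => //.
  by apply: measurable_rVD; [exact: measurable_cst|exact: measurable_id].
have mte (A : set 'rV[R]_n.+1) : measurable A -> measurable_fun setT
    (fun z : 'rV[R]_n * measurableTypeR R => (\1_A (z.2 *: e z.1)%R : R)%:E).
  move=> mA; apply/measurable_EFinP; apply: measurable_indic_comp mA.
  apply: measurable_rVZ; first exact: measurable_snd.
  by apply: measurable_e; exact: measurable_fst.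
have mwI (A : set 'rV[R]_n.+1) : measurable A -> measurable_fun setT
    (fun s => (enorm (e s) ^- n)%:E * \int[mu]_t (\1_A (t *: e s)%R)%:E).
  move=> mA; apply: emeasurable_funM.
    by apply: measurable_w; apply: measurable_e; exact: measurable_id.
  by apply: (measurable_fun_fubini_tonelli_F _ (mte _ mA)) => z; rewrite lee_fin.
have w0 k (a : 'rV[R]_k) i : 0 <= (enorm a ^- i)%:E.
  by rewrite lee_fin invr_ge0 exprn_ge0// enorm_ge0.
(* A displacement in [U] joins two points of B_L, so its norm is at most 2 L: this is the origin of
   the factor (2 L)^-n. *)
apply: (@le_trans _ _ (\int[m n.+1]_z ((\1_U z)%:E * (enorm z ^- n)%:E))).
  have -> : m n.+1 V = \int[m n.+1]_z (\1_U z)%:E.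
    rewrite rV_measure_indic// -[LHS](@integral_rV_translation _ _ _ x)//; last first.
      by apply/measurable_EFinP; exact: measurable_indic.
    by apply: eq_integral => z _; rewrite -[\1_U z]/(\1_V (x + z)%R) addrC.
  have L0 : (0 <= L)%R by rewrite (le_trans (enorm_ge0 x))// ltW.
  have c0 : (0 <= (2 * L) ^- n)%R by rewrite invr_ge0 exprn_ge0// mulr_ge0.
  rewrite -ge0_integralZl//; last by apply/measurable_EFinP; exact: measurable_indic.
  apply: ge0_le_integral => //.
  - by move=> z _; rewrite -EFinM lee_fin mulr_ge0.
  - by apply/measurable_EFinP/measurable_funM => //; exact: measurable_cst.
  - apply: emeasurable_funM; first by apply/measurable_EFinP; exact: measurable_indic.
    by apply: measurable_w; exact: measurable_id.
  move=> z _; rewrite -!EFinM lee_fin indicE.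
  have [|_] := boolP (z \in U); last by rewrite mulr0 mul0r.
  rewrite inE /U/= mulr1 mul1r => Vz.
  (* With the convention 0^-1 = 0 the lower bound on the density would fail at z = 0 when n > 0;
     [Vx] excludes that point. *)
  have z0 : (0 < enorm z)%R.
    rewrite lt_def enorm_ge0 enorm_eq0 andbT; apply/eqP => z0.
    by have := Vx _ Vz; rewrite z0 addr0 eqxx.
  have zL : (enorm z <= 2 * L)%R.
    rewrite (_ : z = (x + z) + - x)%R; last by rewrite addrAC subrr add0r.
    rewrite (le_trans (ler_enormD _ _))// enormN mulr2n mulrDl !mul1r lerD// ltW//.
    exact: VL Vz.
  rewrite lef_pV2 ?posrE ?exprn_gt0//; last by rewrite (lt_le_trans z0).
  by rewrite lerXn2r// nnegrE ?enorm_ge0// mulr_ge0.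
rewrite (integral_chart (m1 _ mU) (i0 _)).
apply: ge0_le_integral => //.
- by move=> s _; rewrite mule_ge0//; apply: integral_ge0 => t _; rewrite lee_fin.
- exact: mwI.
- exact: mwI.
move=> s _; apply: lee_wpmul2l => //.
(* By [bisect_chart], reflecting with a = t (1, s) displaces x by (t - b) (1, s); a shift of t by b
   therefore matches the two integrands. *)
pose b := (2 * dotv x (e s) / dotv (e s) (e s))%R.
have mts : measurable_fun setT (fun t : measurableTypeR R => t *: e s)%R.
  by apply: measurable_rVZ; [exact: measurable_id|exact: measurable_cst].
rewrite -(@integral_lebesgue_translation _ (fun t => (\1_U (t *: e s)%R)%:E) (- b)%R);
  last 2 first.
- by apply/measurable_EFinP; exact: measurable_indic_comp.
- by move=> t; rewrite lee_fin.
apply: ge0_le_integral => //.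
- apply/measurable_EFinP; apply: measurable_indic_comp mU.
  apply: measurable_rVZ; last exact: measurable_cst.
  by apply: measurable_funD; [exact: measurable_id|exact: measurable_cst].
- by apply/measurable_EFinP; exact: measurable_indic_comp.
move=> t _; rewrite lee_fin !indicE ler_nat.
have [|//] := boolP (_ \in U); rewrite inE /U/= => Vt.
(* At t = 0 the displaced point is x - b (1, s), the image of x in the hyperplane through 0
   orthogonal to (1, s). It has the norm of x, which [Vx] forbids in V. *)
have t0 : t != 0%R.
  apply/eqP => t0; have := Vx _ Vt; rewrite t0 sub0r => /eqP; apply.
  rewrite /enorm; congr Num.sqrt.
  have e0 := lt0r_neq0 (dotv_e_gt0 s).
  by rewrite !dotvE (dotvC (e s) x) /b; field.
rewrite mem_set//; split; first by rewrite /= bisect_chart.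
set y := (x + _)%R in Vt; rewrite /eball/=.
have te0 : (0 < enorm (t *: e s))%R by rewrite enormZ mulr_gt0// normr_gt0.
(* The midpoint of x and its image y lies on the mirror of a = t (1, s), so a.(x + y) = |a|^2.
   Cauchy-Schwarz then gives |a| <= |x + y| < 2 L. *)
apply: (@le_lt_trans _ _ (enorm (x + y))); last first.
  rewrite (le_lt_trans (ler_enormD _ _))// mulr2n mulrDl !mul1r ltrD//.
  exact: VL Vt.
rewrite -(ler_pM2l te0) -expr2 enorm_sqr.
rewrite (_ : dotv _ _ = dotv (t *: e s) (x + y))%R; first exact: cauchy_schwarz.
have e0 := lt0r_neq0 (dotv_e_gt0 s).
by rewrite /y /b !dotvE (dotvC (e s) x); field.
Qed.

End chart.

(* The value of omega is irrelevant: since the law has total mass 1, its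
   normalizing constant is finite and positive. *)
Lemma reflection_law_ge (R : realType) (d : nat) (L : R) : (1 <= d)%N ->
  @reflection_law R d L setT = 1%E ->
  exists2 k : R, 0 < k & forall (x : 'rV[R]_d) (V : set 'rV[R]_d),
    measurable V -> V `<=` eball L -> (enorm x < L)%R ->
    (forall y, V y -> enorm y != enorm x) ->
    (k%:E * lebesgue_rV R d V <= reflection_law L [set a | V (bisect a x)])%E.
Proof.
case: d => // n _; rewrite /reflection_law subSS subn0.
set c := (_^-1)%E => law1.
have I0 A : (0 <= \int[lebesgue_rV R n.+1]_(x in A) (enorm x ^- n)%:E)%E.
  by apply: integral_ge0 => x _; rewrite lee_fin invr_ge0 exprn_ge0// enorm_ge0.
have om0 : (0 <= omega R n.+1)%E by rewrite mule_ge0.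
have [L0|L0] := ltP 0 L; last first.
  exists 1 => // x V _ _ xL; have := lt_le_trans xL L0.
  by rewrite ltNge enorm_ge0.
have c0 : (0 <= c)%E by rewrite inve_ge0 mule_ge0// lee_fin mulr_ge0// ltW.
(* A factor 0 gives total mass 0, and a factor +oo gives 0 or +oo, never 1. *)
have [r r0 cE] : exists2 r, 0 < r & c = r%:E.
  move: c0 law1; case: c => [r|_|//]; last first.
    have := I0 ([set: 'rV[R]_n.+1] `&` eball (2 * L)); rewrite le_eqVlt.
    case/orP => [/eqP <-|i0]; first by rewrite mule0 => /eqP; rewrite eq_sym onee_eq0.
    by rewrite gt0_mulye.
  rewrite lee_fin le_eqVlt => /orP[/eqP <-|r0 _]; last by exists r.
  by rewrite mul0e => /eqP; rewrite eq_sym onee_eq0.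
exists (r * (2 * L) ^- n) => [|x V mV VL xL Vx].
  by rewrite mulr_gt0// invr_gt0 exprn_gt0// mulr_gt0.
by rewrite cE EFinM -muleA lee_pmul2l// integral_bisect_ge.
Qed.
(** * Polarization *)

Section polarization.
Context {R : realType} {n : nat}.
Implicit Types (a x y : 'rV[R]_n) (f : 'rV[R]_n -> R).
Local Notation mn := (lebesgue_rV R n).

Lemma bisect0r a : bisect a 0 = a.
Proof.
have [->|a0] := eqVneq a 0; last exact: reflect_bisector.
by rewrite /bisect /reflect scaler0 subr0.
Qed.

Lemma bisectK a : involutive (bisect a).
Proof. exact: reflectK. Qed.

Lemma dotv_bisect a x : dotv (bisect a x) a = dotv a a - dotv x a.
Proof.
have [->|a0] := eqVneq a 0; first by rewrite !(dotvC _ 0) !dotv0l subr0.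
have h : dotv a a != 0 by rewrite dotvv_eq0.
by rewrite /bisect /reflect !dotvE; field.
Qed.

(** The correction is positive exactly on the side of 0: there x is nearer to 0 than its mirror
    image. *)
Lemma dotvv_bisect a x :
  dotv (bisect a x) (bisect a x) = dotv x x + (dotv a a - 2 * dotv x a).
Proof.
have [->|a0] := eqVneq a 0.
  by rewrite /bisect /reflect scaler0 subr0 (dotvC _ 0) !dotv0l mulr0 subr0 addr0.
have h : dotv a a != 0 by rewrite dotvv_eq0.
by rewrite /bisect /reflect !dotvE (dotvC a x); field.
Qed.

Lemma polarizeE a f x : polarize (bisect a) f x =
  if dotv x a < dotv a a / 2 then Num.max (f x) (f (bisect a x))
  else if dotv a a / 2 < dotv x a then Num.min (f x) (f (bisect a x)) else f x.
Proof.
rewrite /polarize /mirror_pos /mirror_neg bisect0r.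
rewrite (_ : (x \in [set x | dotv x a < _]) = (dotv x a < dotv a a / 2)); last first.
  by apply/idP/idP; rewrite inE.
rewrite (_ : (x \in [set x | _ < dotv x a]) = (dotv a a / 2 < dotv x a))//.
by apply/idP/idP; rewrite inE.
Qed.

(* Folding the space along the hyperplane: x on the side of 0 carries the mass
   of both x and its mirror image. *)
Lemma le_integral_fold a (g1 g2 : 'rV[R]_n -> \bar R) :
  measurable_fun [set: 'rV[R]_n] g1 -> measurable_fun [set: 'rV[R]_n] g2 ->
  (forall x, 0 <= g1 x)%E -> (forall x, 0 <= g2 x)%E ->
  (forall x, (dotv x a < dotv a a / 2)%R ->
    g1 x + g1 (bisect a x) <= g2 x + g2 (bisect a x))%E ->
  (forall x, dotv x a = (dotv a a / 2)%R -> g1 x <= g2 x)%E ->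
  (\int[mn]_x g1 x <= \int[mn]_x g2 x)%E.
Proof.
move=> m1 m2 g10 g20 gp g0.
have mb : measurable_fun [set: 'rV[R]_n] (bisect a) by exact: measurable_reflectT.
pose N := [set x : 'rV[R]_n | dotv a a / 2 < dotv x a].
pose Q := [set x : 'rV[R]_n | dotv x a < dotv a a / 2].
have inN x : (x \in N) = (dotv a a / 2 < dotv x a) by apply/idP/idP; rewrite inE.
have inQ x : (x \in Q) = (dotv x a < dotv a a / 2) by apply/idP/idP; rewrite inE.
have ma : measurable_fun [set: 'rV[R]_n] (fun x => dotv x a).
  by apply: measurable_dotv; [exact: measurable_id|exact: measurable_cst].
have mN : measurable N.
  rewrite -[X in measurable X]setTI
    (_ : N = (fun x => dotv x a) @^-1` `]dotv a a / 2, +oo[%classic).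
    by apply: ma => //; exact: measurable_itv.
  by apply/seteqP; split => x /=; rewrite in_itv/= andbT.
have mQ : measurable Q.
  rewrite -[X in measurable X]setTI
    (_ : Q = (fun x => dotv x a) @^-1` `]-oo, dotv a a / 2[%classic).
    by apply: ma => //; exact: measurable_itv.
  by apply/seteqP; split => x /=; rewrite in_itv/=.
have mI (A : set 'rV[R]_n) : measurable A ->
    measurable_fun [set: 'rV[R]_n] (fun x => (\1_A x : R)%:E).
  by move=> mA; apply/measurable_EFinP; exact: measurable_indic.
have I0 (A : set 'rV[R]_n) x : (0 <= (\1_A x : R)%:E)%E by rewrite lee_fin.
(* The half-space [N] beyond the mirror is carried onto [Q]. The mirror itself stays in the first
   term, which is why it has its own pointwise hypothesis. *)
have fold (g : 'rV[R]_n -> \bar R) : measurable_fun [set: 'rV[R]_n] g -> (forall x, 0 <= g x)%E ->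
    (\int[mn]_x g x = \int[mn]_x ((\1_(~` N) x)%:E * g x + (\1_Q x)%:E * g (bisect a x)))%E.
  move=> mg gg0; have mgb : measurable_fun [set: 'rV[R]_n] (g \o bisect a).
    exact: measurableT_comp.
  transitivity (\int[mn]_x ((\1_(~` N) x)%:E * g x + (\1_N x)%:E * g x))%E.
    apply: eq_integral => x _; rewrite !indicE in_setC.
    by case: (x \in N); rewrite ?mul0e ?mul1e ?add0e ?adde0.
  have mNC := measurableC mN.
  rewrite !ge0_integralD//; try by [move=> x _; exact: mule_ge0
    |apply: emeasurable_funM => //; exact: mI].
  congr (_ + _)%E; rewrite -[LHS](@integral_reflect _ _ a (dotv a a / 2))//; last 2 first.
  - by apply: emeasurable_funM => //; exact: mI.
  - by move=> x; exact: mule_ge0.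
  apply: eq_integral => x _; rewrite -/(bisect a x) !indicE inN inQ dotv_bisect.
  by congr ((nat_of_bool _)%:R%:E * _)%E; apply/idP/idP; lra.
rewrite (fold _ m1 g10) (fold _ m2 g20); apply: ge0_le_integral => //.
- by move=> x _; rewrite adde_ge0// mule_ge0.
- apply: emeasurable_funD; apply: emeasurable_funM => //; try exact: mI.
    by apply: mI; exact: measurableC.
  exact: measurableT_comp.
- apply: emeasurable_funD; apply: emeasurable_funM => //; try exact: mI.
    by apply: mI; exact: measurableC.
  exact: measurableT_comp.
move=> x _; rewrite !indicE in_setC inN inQ.
have [xl|xg|xe] := ltgtP (dotv x a) (dotv a a / 2).
- by rewrite !mul1e; exact: gp.
- by rewrite !mul0e adde0.
- by rewrite !mul1e !mul0e !adde0; exact: g0.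
Qed.

Lemma mem_setb (T : Type) (b : T -> bool) (x : T) : (x \in [set y | b y]) = b x.
Proof. by apply/idP/idP; rewrite inE. Qed.

(** Polarization commutes with taking superlevel sets: union with the mirror image on the side of 0,
    intersection beyond. Thus all estimates can be made on sets, level by level. *)
Lemma lt_polarize t a f x : (t < polarize (bisect a) f x) =
  if dotv x a < dotv a a / 2 then (t < f x) || (t < f (bisect a x))
  else if dotv a a / 2 < dotv x a then (t < f x) && (t < f (bisect a x)) else t < f x.
Proof. by rewrite polarizeE; case: ifP => _; [rewrite lt_max|case: ifP => _; rewrite ?lt_min]. Qed.

(** Function, reflection and point all depend on the parameter, because Tonelli's theorem needs
    joint measurability in the random outcome and the point. *)
Lemma measurable_polarize d (T : measurableType d) (g : T -> 'rV[R]_n -> R)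
    (u v : T -> 'rV[R]_n) :
  measurable_fun [set: T] u -> measurable_fun [set: T] v ->
  measurable_fun [set: T] (fun z => g z (v z)) ->
  measurable_fun [set: T] (fun z => g z (bisect (u z) (v z))) ->
  measurable_fun [set: T] (fun z => polarize (bisect (u z)) (g z) (v z)).
Proof.
move=> mu mv mg mgb.
have mvu : measurable_fun [set: T] (fun z => dotv (v z) (u z)) by exact: measurable_dotv.
have muu : measurable_fun [set: T] (fun z => dotv (u z) (u z) / 2).
  by apply: measurable_funM; [exact: measurable_dotv|exact: measurable_cst].
under eq_fun do rewrite polarizeE.
apply: measurable_fun_ifT; first exact: measurable_fun_ltr.
  exact: measurable_maxr.
by apply: measurable_fun_ifT => //; [exact: measurable_fun_ltr|exact: measurable_minr].
Qed.

Variables (a : 'rV[R]_n) (f : 'rV[R]_n -> R) (t : R).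
Hypothesis mf : measurable_fun [set: 'rV[R]_n] f.
Local Notation s := (bisect a).
Local Notation A := [set x | t < f x].
Local Notation A' := [set x | t < polarize s f x].

Lemma measurable_lt_fun d (T : measurableType d) (g : T -> R) : measurable_fun [set: T] g ->
  measurable [set x | t < g x].
Proof.
move=> mg; rewrite -[X in measurable X]setTI (_ : [set x | _] = g @^-1` `]t, +oo[%classic).
  by apply: mg => //; exact: measurable_itv.
by apply/seteqP; split => x /=; rewrite in_itv/= andbT.
Qed.

Let ms : measurable_fun [set: 'rV[R]_n] s.
Proof. exact: measurable_reflectT. Qed.

Let mpf : measurable_fun [set: 'rV[R]_n] (polarize s f).
Proof.
apply: (@measurable_polarize _ _ (fun=> f) (fun=> a) id) => //.
exact: measurableT_comp.
Qed.

Let pos_mirror x : dotv x a < dotv a a / 2 ->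
  (dotv (s x) a < dotv a a / 2) = false /\ dotv a a / 2 < dotv (s x) a.
Proof. by move=> h; rewrite dotv_bisect; split; [apply/negbTE|]; lra. Qed.

(** In every pair {x, s x} the two sets have equally many points; folding gives both
    inequalities. *)
Lemma polarize_measure : mn A' = mn A.
Proof.
have mA := measurable_lt_fun mf; have mA' := measurable_lt_fun mpf.
have I0 (B : set 'rV[R]_n) x : (0 <= (\1_B x : R)%:E)%E by rewrite lee_fin.
have mI (B : set 'rV[R]_n) : measurable B ->
    measurable_fun [set: 'rV[R]_n] (fun x => (\1_B x : R)%:E).
  by move=> mB; apply/measurable_EFinP; exact: measurable_indic.
rewrite !rV_measure_indic//; apply/eqP; rewrite eq_le; apply/andP; split;
  apply: (@le_integral_fold a); try exact: mI; try exact: I0.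
- move=> x xa; have [h1 h2] := pos_mirror xa.
  rewrite !indicE !mem_setb !lt_polarize xa h1 h2 bisectK -!EFinD lee_fin.
  by case: (t < f x); case: (t < f (s x)); rewrite /= ?addr0 ?add0r.
- by move=> x xa; rewrite !indicE !mem_setb !lt_polarize xa ltxx.
- move=> x xa; have [h1 h2] := pos_mirror xa.
  rewrite !indicE !mem_setb !lt_polarize xa h1 h2 bisectK -!EFinD lee_fin.
  by case: (t < f x); case: (t < f (s x)); rewrite /= ?addr0 ?add0r.
- by move=> x xa; rewrite !indicE !mem_setb !lt_polarize xa ltxx.
Qed.

Variable B : set 'rV[R]_n.
Hypothesis mB : measurable B.
Hypothesis Bradial : forall x y, B y -> enorm x <= enorm y -> B x.

(* A pair {x, s x} contributes to the second term only if polarization moves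
   its point of A from outside B into B. *)
Lemma polarize_setD_measure :
  (mn (A' `\` B) + mn ((A `\` B) `&` s @^-1` (B `\` A)) <= mn (A `\` B))%E.
Proof.
have mA := measurable_lt_fun mf; have mA' := measurable_lt_fun mpf.
have mAB := measurableD mA mB; have mA'B := measurableD mA' mB.
have mH : measurable ((A `\` B) `&` s @^-1` (B `\` A)).
  apply: measurableI => //; apply: measurable_preimage_rV => //.
  exact: measurableD.
have mI (C : set 'rV[R]_n) : measurable C ->
    measurable_fun [set: 'rV[R]_n] (fun x => (\1_C x : R)%:E).
  by move=> mC; apply/measurable_EFinP; exact: measurable_indic.
have I0 (C : set 'rV[R]_n) x : (0 <= (\1_C x : R)%:E)%E by rewrite lee_fin.
have inH x : (x \in (A `\` B) `&` s @^-1` (B `\` A)) =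
    [&& t < f x, x \notin B, s x \in B & ~~ (t < f (s x))].
  rewrite in_setI in_setD mem_setb -andbA.
  by rewrite -[x \in _ @^-1` _]/(s x \in B `\` A) in_setD mem_setb.
rewrite !rV_measure_indic// -ge0_integralD//; try exact: mI.
apply: (@le_integral_fold a).
- by apply: emeasurable_funD; exact: mI.
- exact: mI.
- by move=> x; rewrite adde_ge0.
- exact: I0.
- move=> x xa; have [h1 h2] := pos_mirror xa.
  (* x is the point of the pair nearer to 0 and B is a centered ball. This excludes s x in B with x
     outside, where the inequality can fail; the other memberships are a finite check. *)
  have BB : s x \in B -> x \in B.
    rewrite !inE => /Bradial; apply; rewrite ltW// enorm_ltE dotvv_bisect; lra.
  rewrite !indicE !inH !in_setD !mem_setb !lt_polarize xa h1 h2 bisectK -!EFinD lee_fin.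
  move: BB; case: (t < f x); case: (t < f (s x)); case: (x \in B); case: (s x \in B) => //= BB;
    by rewrite ?addr0 ?add0r//; have := BB isT.
- move=> x xa; rewrite !indicE inH !in_setD !mem_setb !lt_polarize xa ltxx -!EFinD lee_fin.
  have sx : s x = x.
    by rewrite /bisect /reflect xa subrr mulr0 mul0r scale0r subr0.
  by rewrite sx; case: (t < f x); case: (x \in B); rewrite /= ?addr0 ?add0r.
Qed.

End polarization.
(** * Independence and the expected effect of one polarization *)

Section sections.
Context {R : realType} d1 d2 (T1 : measurableType d1) (T2 : measurableType d2).
Variables (m1 : {sigma_finite_measure set T1 -> \bar R}).
Variables (m2 : {sigma_finite_measure set T2 -> \bar R}).
Variable Q : T1 -> T2 -> Prop.
Hypothesis mQ : measurable [set z : T1 * T2 | Q z.1 z.2].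
Local Notation S := [set z : T1 * T2 | Q z.1 z.2].
Local Open Scope ereal_scope.

Let mS : measurable_fun [set: T1 * T2] (fun z => (\1_S z : R)%:E).
Proof. by apply/measurable_EFinP; exact: measurable_indic. Qed.

Lemma measurable_section1 w : measurable [set x | Q w x].
Proof.
rewrite (_ : [set x | _] = xsection S w); first exact: measurable_xsection.
by apply/seteqP; split => x; rewrite /xsection/= inE.
Qed.

Lemma measurable_section2 x : measurable [set w | Q w x].
Proof.
rewrite (_ : [set w | _] = ysection S x); first exact: measurable_ysection.
by apply/seteqP; split => w; rewrite /ysection/= inE.
Qed.

Let section_indic w : m2 [set x | Q w x] = \int[m2]_x (\1_S (w, x))%:E.
Proof.
rewrite -[RHS]/(\int[m2]_x (\1_[set x | Q w x] x)%:E).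
by rewrite integral_indic ?setIT//; exact: measurable_section1.
Qed.

Lemma measurable_measure_section :
  measurable_fun [set: T1] (fun w => m2 [set x | Q w x]).
Proof.
under eq_fun do rewrite section_indic.
by apply: (measurable_fun_fubini_tonelli_F _ mS) => z; rewrite lee_fin.
Qed.

(** Tonelli's theorem for an indicator: it exchanges outcomes with points and, later, points with
    levels. *)
Lemma integral_measure_section :
  \int[m1]_w m2 [set x | Q w x] = \int[m2]_x m1 [set w | Q w x].
Proof.
under eq_integral do rewrite section_indic.
rewrite (fubini_tonelli _ mS); last by move=> z; rewrite lee_fin.
apply: eq_integral => x _.
rewrite -[LHS]/(\int[m1]_w (\1_[set w | Q w x] w)%:E).
by rewrite integral_indic ?setIT//; exact: measurable_section2.
Qed.

End sections.

Section independence.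
Context {R : realType} d (T : measurableType d) (P : probability T R).
Local Open Scope ereal_scope.

Lemma integral_probability_cst (c : \bar R) : \int[P]_w (cst c w) = c.
Proof.
rewrite integral_cst//= -[RHS]mule1; congr (_ * _); exact: probability_setT.
Qed.

(** The joint law and the product of the laws agree on rectangles, hence everywhere; Tonelli's
    theorem then integrates the second variable over an independent copy w'. *)
Lemma integral_independent d1 d2 (U1 : measurableType d1) (U2 : measurableType d2)
    (X : {mfun T >-> U1}) (Y : {mfun T >-> U2}) (F : U1 * U2 -> \bar R) :
  (forall A B, measurable A -> measurable B ->
    P (X @^-1` A `&` Y @^-1` B) = P (X @^-1` A) * P (Y @^-1` B)) ->
  measurable_fun [set: U1 * U2] F -> (forall z, 0 <= F z) ->
  \int[P]_w F (X w, Y w) = \int[P]_w \int[P]_w' F (X w, Y w').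
Proof.
move=> indep mF F0.
pose Z w := (X w, Y w).
have mZ : measurable_fun [set: T] Z by apply/measurable_fun_pairP; split.
rewrite -[LHS]/(\int[P]_(w in Z @^-1` setT) (F \o Z) w).
rewrite -ge0_integral_pushforward//.
transitivity (\int[(distribution P X \x distribution P Y)%E]_z F z).
  apply/esym/eq_measure_integral => A mA _.
  apply: product_measure_unique mA => B C mB mC; exact: indep.
rewrite fubini_tonelli1// ge0_integral_distribution//; last 2 first.
- exact: measurable_fun_fubini_tonelli_F.
- by move=> x; exact: integral_ge0.
apply: eq_integral => w _ /=; rewrite /fubini_F ge0_integral_distribution//.
exact: measurableT_comp mF (pair1_measurable _).
Qed.

Context dV (V : measurableType dV).
Variable (X : nat -> T -> V).
Hypothesis mX : forall i, measurable_fun [set: T] (X i).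
Hypothesis indepX : mutually_independent P X.

(** A generating family stable under intersection, on which independence is immediate. *)
Definition cylinders n : set (set T) := [set A | exists2 B : nat -> set V,
  forall i, measurable (B i) & A = \bigcap_(i in [set` iota 0 n]) X i @^-1` B i].

(* T with the sigma-algebra generated by X 0, ..., X n.-1. *)
Definition history n := g_sigma_algebraType (cylinders n).

Lemma cylinders_setI n : setI_closed (cylinders n).
Proof.
move=> _ _ [A mA ->] [B mB ->]; exists (fun i => A i `&` B i).
  by move=> i; exact: measurableI.
by rewrite -bigcapI.
Qed.

Lemma measurable_cylinders n : cylinders n `<=` measurable.
Proof.
move=> _ [A mA ->]; apply: bigcap_measurableType => i _.
by rewrite -[X in measurable X]setTI; exact: mX.
Qed.

Lemma measurable_history n i : (i < n)%N ->
  measurable_fun [set: history n] (X i : history n -> V).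
Proof.
move=> lt_in _ B mB; rewrite setTI; apply: sub_sigma_algebra.
exists (fun j => if j == i then B else setT) => [j|]; first by case: ifP.
apply/seteqP; split => w /=.
  by move=> Bw j _ /=; case: eqP => [->|].
by move=> /(_ i); rewrite /= mem_iota add0n eqxx; exact.
Qed.

Lemma measurable_history_id n : measurable_fun [set: T] (id : T -> history n).
Proof.
move=> _ A mA; rewrite setTI; apply: (smallest_sub _ _ mA).
  exact: sigma_algebra_measurable.
exact: measurable_cylinders.
Qed.

(** For a fixed event {X n in B}, both sides are finite measures in A that agree on the cylinders,
    hence on the sigma-algebra these generate. *)
Lemma history_independent n (A : set T) (B : set V) :
  <<s cylinders n >> A -> measurable B ->
  P (A `&` X n @^-1` B) = P A * P (X n @^-1` B).
Proof.
move=> sA mB; pose Y := X n @^-1` B.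
have mY : measurable Y by rewrite -[X in measurable X]setTI; exact: mX.
pose r := NngNum (fine_ge0 (measure_ge0 P Y)).
have rE : r%:num%:E = P Y by rewrite fineK// fin_num_measure.
rewrite muleC -rE -[LHS]/(mrestr P mY A) -[RHS]/(mscale r P A).
apply: (g_sigma_algebra_measure_unique (cylinders n) _ (fun=> setT)) sA.
- exact: measurable_cylinders.
- by move=> _; exists (fun=> setT) => //; rewrite bigcapT.
- by rewrite bigcup_const.
- exact: cylinders_setI.
- move=> _ [C mC ->]; rewrite -[LHS]/(P (_ `&` Y)) -[RHS]/(r%:num%:E * P _) rE.
  (* Placing B at index n makes the event a cylinder over n + 1 variables, to which independence
     applies. *)
  pose C' i := if i == n then B else C i.
  have mC' i : measurable (C' i) by rewrite /C'; case: ifP.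
  have C'E i : i \in iota 0 n -> C' i = C i.
    by rewrite mem_iota add0n /C' => /ltn_eqF ->.
  have C'n : C' n = B by rewrite /C' eqxx.
  have := indepX (iota_uniq 0 n.+1) mC'.
  rewrite -addn1 iotaD big_cat big_seq1 /= add0n C'n muleC => EC.
  rewrite (indepX (iota_uniq 0 n) mC) muleC.
  transitivity (P (\bigcap_(i in [set` iota 0 n ++ [:: n]]) X i @^-1` C' i)).
    congr (P _); apply/seteqP; split => w /=.
      move=> [Cw Bw] i /=; rewrite mem_cat inE => /orP[/[dup] il /C'E ->|/eqP ->].
        exact: Cw.
      by rewrite C'n.
    move=> Cw; split => [i /= il|]; first by rewrite -C'E//; apply: Cw; rewrite /= mem_cat il.
    by have := Cw n; rewrite /= mem_cat inE eqxx orbT C'n; exact.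
  rewrite EC muleC; congr (_ * _).
  by apply: eq_big_seq => i il; rewrite C'E.
- by move=> k; rewrite /mrestr (le_lt_trans (probability_le1 _ _)) ?ltry//; exact: measurableI.
Qed.
End independence.

(** * Random polarizations: one step and the recursion *)

Section random_polarization.
Context {R : realType} {n : nat}.
Local Notation mn := (lebesgue_rV R n).
Local Open Scope ereal_scope.

(** The induction lets the point vary with z: the last polarization evaluates the earlier function
    also at the mirror image, which moves with the random reflection. *)
Lemma measurable_polarize_seq d (U : measurableType d) (X : nat -> U -> 'rV[R]_n)
    (f : 'rV[R]_n -> R) (x : U -> 'rV[R]_n) k :
  measurable_fun [set: 'rV[R]_n] f ->
  (forall i, (i < k)%N -> measurable_fun [set: U] (X i)) ->
  measurable_fun [set: U] x ->
  measurable_fun [set: U] (fun z => polarize_seq (fun i => bisect (X i z)) k f (x z)).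
Proof.
move=> mf; elim: k x => [|k IH] x mX mx /=; first exact: measurableT_comp.
have mXk : measurable_fun [set: U] (X k) by exact: mX.
have {}IH y : measurable_fun [set: U] y -> measurable_fun [set: U]
    (fun z => polarize_seq (fun i => bisect (X i z)) k f (y z)).
  by apply: IH => i ik; apply: mX; rewrite ltnS ltnW.
apply: (@measurable_polarize _ _ _ _
  (fun z => polarize_seq (fun i => bisect (X i z)) k f) (X k) x) => //; apply: IH => //.
exact: measurable_bisect.
Qed.

Lemma measure_setD_eq (A B : set 'rV[R]_n) : measurable A -> measurable B ->
  mn A = mn B -> mn A < +oo -> mn (B `\` A) = mn (A `\` B).
Proof.
move=> mA mB AB Aoo.
have fI : mn (A `&` B) \is a fin_num.
  rewrite ge0_fin_numE// (le_lt_trans _ Aoo)// le_measure// ?inE//.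
  exact: measurableI.
have EA := measureDI mn mA mB; have EB := measureDI mn mB mA; rewrite setIC in EB.
rewrite -[LHS](@addeK _ (mn (A `&` B)))// -[RHS](@addeK _ (mn (A `&` B)))// -EA -EB.
by congr (_ - _); exact/esym.
Qed.

Section step.
Context d (T : measurableType d) (P : probability T R) (Y : T -> 'rV[R]_n).
Hypothesis mY : measurable_fun [set: T] Y.
Variables (L k : R).
Hypothesis k0 : (0 <= k)%R.
Hypothesis Yge : forall (x : 'rV[R]_n) (V : set 'rV[R]_n),
  measurable V -> V `<=` eball L -> (enorm x < L)%R ->
  (forall y, V y -> enorm y != enorm x) ->
  k%:E * mn V <= P [set w | V (bisect (Y w) x)].

(** By Tonelli's theorem the expected gain is the integral over x in A \ B of the probability that
    the mirror image of x lies in B \ A; [Yge] bounds this probability below. *)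
Lemma expected_polarize_le (g : 'rV[R]_n -> R) (t : R) (B : set 'rV[R]_n) :
  let A := [set x | (t < g x)%R] in
  measurable_fun [set: 'rV[R]_n] g -> measurable B ->
  (forall x y, B y -> (enorm x <= enorm y)%R -> B x) ->
  A `<=` eball L -> B `<=` eball L -> mn A = mn B ->
  \int[P]_w mn ([set x | (t < polarize (bisect (Y w)) g x)%R] `\` B)
    + k%:E * (mn (A `\` B) * mn (A `\` B)) <= mn (A `\` B).
Proof.
move=> A mg mB Brad AL BL AB.
have mA : measurable A by exact: measurable_lt_fun.
have Aoo : mn A < +oo.
  apply: (le_lt_trans _ (eball_measure_fin n L)); apply: le_measure; rewrite ?inE//.
  exact: measurable_eball.
have mfst : measurable_fun setT (fun z : T * 'rV[R]_n => Y z.1).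
  by apply: measurableT_comp => //; exact: measurable_fst.
have msnd : measurable_fun setT (fun z : T * 'rV[R]_n => z.2) by exact: measurable_snd.
have mb : measurable_fun setT (fun z : T * 'rV[R]_n => bisect (Y z.1) z.2).
  exact: measurable_bisect.
pose Q1 w x := ([set x | (t < polarize (bisect (Y w)) g x)%R] `\` B) x.
pose Q2 w x := ((A `\` B) `&` (bisect (Y w)) @^-1` (B `\` A)) x.
have mQ1 : measurable [set z : T * 'rV[R]_n | Q1 z.1 z.2].
  rewrite (_ : [set z | _] = [set z | (t < polarize (bisect (Y z.1)) g z.2)%R] `\`
      (snd @^-1` B))//; apply: measurableD.
    apply: measurable_lt_fun; apply: measurable_polarize => //; exact: measurableT_comp.
  exact: measurable_preimage_rV.
have mQ2 : measurable [set z : T * 'rV[R]_n | Q2 z.1 z.2].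
  apply: measurableI.
    by apply: (@measurable_preimage_rV _ _ _ _ snd (A `\` B)) => //; exact: measurableD.
  apply: (@measurable_preimage_rV _ _ _ _ (fun z => bisect (Y z.1) z.2) (B `\` A)) => //.
  exact: measurableD.
apply: (@le_trans _ _ (\int[P]_w mn [set x | Q1 w x] + \int[P]_w mn [set x | Q2 w x])).
  rewrite leeD2l// integral_measure_section//.
  have E : mn (A `\` B) = \int[mn]_x (\1_(A `\` B) x)%:E.
    by apply: rV_measure_indic; exact: measurableD.
  rewrite muleA [X in _ * X]E.
  have c0 : 0 <= k%:E * mn (A `\` B) by rewrite mule_ge0.
  rewrite -ge0_integralZl//; last first.
    by apply/measurable_EFinP; apply: measurable_indic; exact: measurableD.
  apply: ge0_le_integral => //.
  - by move=> x _; rewrite mule_ge0// lee_fin.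
  - apply: emeasurable_funM; first exact: measurable_cst.
    by apply/measurable_EFinP; apply: measurable_indic; exact: measurableD.
  - have := @measurable_measure_section _ _ _ _ _ P (fun x w => Q2 w x); apply.
    rewrite (_ : [set z | _] = (fun z => (z.2, z.1)) @^-1` [set z : T * 'rV[R]_n | Q2 z.1 z.2])//.
    rewrite -[X in measurable X]setTI.
    suff : measurable_fun setT (fun z : 'rV[R]_n * T => (z.2, z.1)) by exact.
    by apply/measurable_fun_pairP; split; [exact: measurable_snd|exact: measurable_fst].
  move=> x _; rewrite indicE; have [|_] := boolP (x \in _); last by rewrite mule0.
  rewrite inE => -[Ax Bx]; rewrite mule1 -measure_setD_eq//.
  apply: (le_trans (Yge (measurableD mB mA) _ (AL _ Ax) _)).
  - by apply: subset_trans BL; exact: subDsetl.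
  (* A point of the centered ball B and a point outside it have different norms. *)
  - move=> y [By _]; apply: contra_not_neq Bx => yx.
    by apply: Brad By _; rewrite yx.
  - apply: le_measure; rewrite ?inE//.
    + apply: (@measurable_preimage_rV _ _ _ _ (fun w => bisect (Y w) x)).
        by apply: measurable_bisect => //; exact: measurable_cst.
      exact: measurableD.
    + exact: (@measurable_section2 _ _ _ _ Q2).
rewrite -ge0_integralD//; last 2 first.
- exact: measurable_measure_section.
- exact: measurable_measure_section.
apply: (@le_trans _ _ (\int[P]_w (cst (mn (A `\` B)) w))); last first.
  by rewrite integral_probability_cst.
apply: ge0_le_integral => //.
- by move=> w _; rewrite adde_ge0.
- by apply: emeasurable_funD; exact: measurable_measure_section.
by move=> w _; exact: polarize_setD_measure.
Qed.

End step.

Section recursion.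
Context d (T : measurableType d) (P : probability T R) (X : nat -> T -> 'rV[R]_n).
Hypothesis mX : forall i, measurable_fun [set: T] (X i).
Hypothesis indepX : mutually_independent P X.
Variables (L k : R).
Hypothesis k0 : (0 <= k)%R.
Hypothesis Xge : forall i (x : 'rV[R]_n) (V : set 'rV[R]_n),
  measurable V -> V `<=` eball L -> (enorm x < L)%R ->
  (forall y, V y -> enorm y != enorm x) ->
  k%:E * mn V <= P [set w | V (bisect (X i w) x)].
Variables (f : 'rV[R]_n -> R) (t : R) (B : set 'rV[R]_n).
Hypothesis mf : measurable_fun [set: 'rV[R]_n] f.
Hypothesis mB : measurable B.
Hypothesis Brad : forall x y, B y -> (enorm x <= enorm y)%R -> B x.
Hypothesis fL : forall x, (t < f x)%R -> eball L x.
Hypothesis BL : B `<=` eball L.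
Hypothesis fB : mn [set x | (t < f x)%R] = mn B.

Let F i w := polarize_seq (fun j => bisect (X j w)) i f.
Let D i w := mn ([set x | (t < F i w x)%R] `\` B).

Let mF d' (S : measurableType d') i (u : S -> T) (v : S -> 'rV[R]_n) :
  measurable_fun [set: S] u -> measurable_fun [set: S] v ->
  measurable_fun [set: S] (fun z => F i (u z) (v z)).
Proof.
move=> mu mv; apply: (@measurable_polarize_seq _ _ (fun j z => X j (u z))) => // j _.
exact: measurableT_comp (mX j) mu.
Qed.

Let mFw i w : measurable_fun [set: 'rV[R]_n] (F i w).
Proof. by apply: (@mF _ _ i (fun=> w) id). Qed.

Lemma measurable_excess i : measurable_fun [set: T] (D i).
Proof.
apply: (@measurable_measure_section _ _ _ _ _ mn
  (fun w x => ([set x | (t < F i w x)%R] `\` B) x)).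
rewrite (_ : [set z | _] = [set z | (t < F i z.1 z.2)%R] `\` (snd @^-1` B))//.
apply: measurableD; last exact: measurable_preimage_rV.
by apply: measurable_lt_fun; apply: mF; [exact: measurable_fst|exact: measurable_snd].
Qed.

(** A point acquired by a superlevel set is nearer to 0 than its mirror image, which was already in
    the ball. *)
Lemma polarize_seq_measure i w :
  mn [set x | (t < F i w x)%R] = mn [set x | (t < f x)%R] /\
  [set x | (t < F i w x)%R] `<=` eball L.
Proof.
elim: i => [|i [IHm IHL]] //=; split.
  by rewrite polarize_measure//; exact: mFw.
move=> x /=; rewrite lt_polarize; case: ifP => [xpos /orP[|xs]|_].
- exact: IHL.
- have := IHL _ xs; apply: le_lt_trans; rewrite ltW// enorm_ltE dotvv_bisect; lra.
by case: ifP => _ => [/andP[+ _]|]; exact: IHL.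
Qed.

(* The gain of expected_polarize_le is quadratic in D i; it is made linear by
   (D i - s)^2 >= 0, which replaces Jensen's inequality. *)
Lemma expected_excess_le i (s : R) : (0 <= s)%R ->
  \int[P]_w D i.+1 w + (2 * k * s)%:E * \int[P]_w D i w <=
  \int[P]_w D i w + (k * s ^+ 2)%:E.
Proof.
move=> s0.
pose H := history X i.
(* The first i polarizations depend on the outcome only through X 0, ..., X (i - 1); typed on [H],
   they are measurable for a sigma-algebra independent of X i. *)
pose Fh (h : H) := polarize_seq (fun j => bisect ((X j : H -> 'rV[R]_n) h)) i f.
pose Q (z : H * 'rV[R]_n) (x : 'rV[R]_n) :=
  ([set x | (t < polarize (bisect z.2) (Fh z.1) x)%R] `\` B) x.
pose G (z : H * 'rV[R]_n) := mn (Q z).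
have mG : measurable_fun [set: H * 'rV[R]_n] G.
  apply: (@measurable_measure_section _ _ _ _ _ mn Q).
  rewrite (_ : [set z | _] = [set z | (t < polarize (bisect z.1.2) (Fh z.1.1) z.2)%R]
    `\` (snd @^-1` B))//; apply: measurableD; last exact: measurable_preimage_rV.
  have m11 : measurable_fun setT (fun z : H * 'rV[R]_n * 'rV[R]_n => z.1.1).
    by apply: measurableT_comp; [exact: measurable_fst|exact: measurable_fst].
  have m12 : measurable_fun setT (fun z : H * 'rV[R]_n * 'rV[R]_n => z.1.2).
    by apply: measurableT_comp; [exact: measurable_snd|exact: measurable_fst].
  have mh (v : H * 'rV[R]_n * 'rV[R]_n -> 'rV[R]_n) : measurable_fun setT v ->
      measurable_fun setT (fun z => Fh z.1.1 (v z)).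
    move=> mv; apply: (@measurable_polarize_seq _ _
      (fun j (z : H * 'rV[R]_n * 'rV[R]_n) => (X j : H -> 'rV[R]_n) z.1.1)) => // j ji.
    by apply: measurableT_comp m11; exact: measurable_history.
  apply: measurable_lt_fun; apply: (@measurable_polarize _ _ _ _
    (fun z : H * 'rV[R]_n * 'rV[R]_n => Fh z.1.1) (fun z => z.1.2) snd) => //.
  - by apply: mh; exact: measurable_snd.
  - by apply: mh; apply: measurable_bisect => //; exact: measurable_snd.
have mX1 := isMeasurableFun.Build _ _ _ _ _ (measurable_history_id mX (n := i)).
pose X1 : {mfun T >-> H} := HB.pack (id : T -> H) mX1.
have mX2 := isMeasurableFun.Build _ _ _ _ _ (mX i).
pose X2 : {mfun T >-> 'rV[R]_n} := HB.pack (X i) mX2.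
(* The last reflection is drawn from an independent copy w' while the earlier ones remain at w. *)
have DG : \int[P]_w D i.+1 w = \int[P]_w \int[P]_w' G (w, X i w').
  apply: (@integral_independent _ _ _ P _ _ _ _ X1 X2 G) => //.
  by move=> A C mA mC; exact: history_independent.
have mGw : measurable_fun [set: T] (fun w => \int[P]_w' G (w, X i w')).
  have := @measurable_fun_fubini_tonelli_F _ _ T T R P (fun z => G (z.1, X i z.2)).
  apply => //.
  have mp : measurable_fun [set: T * T] (fun z : T * T => ((z.1 : H), X i z.2)).
    apply/measurable_fun_pairP; split.
      by apply: (measurableT_comp (measurable_history_id mX (n := i))); exact: measurable_fst.
    by apply: (measurableT_comp (mX i)); exact: measurable_snd.
  exact: measurableT_comp mG mp.
have G0 w : 0 <= \int[P]_w' G (w, X i w') by exact: integral_ge0.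
have ks0 : (0 <= 2 * k * s)%R by rewrite !mulr_ge0.
have kss0 : (0 <= k * s ^+ 2)%R by rewrite mulr_ge0// sqr_ge0.
have mD := measurable_excess i.
have D0 w : 0 <= D i w by [].
rewrite DG -ge0_integralZl//.
rewrite -ge0_integralD//; last 2 first.
- by move=> w _; rewrite mule_ge0.
- exact: measurable_funeM.
have -> : (k * s ^+ 2)%:E = \int[P]_w (cst (k * s ^+ 2)%:E w).
  by rewrite integral_probability_cst.
rewrite -ge0_integralD//.
apply: ge0_le_integral => //.
- by move=> w _; rewrite adde_ge0// mule_ge0.
- by apply: emeasurable_funD => //; exact: measurable_funeM.
- exact: emeasurable_funD.
move=> w _.
(* With w fixed, [F i w] is deterministic and the one-step estimate applies to it. *)
have [Em EL] := polarize_seq_measure i w.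
have := expected_polarize_le (mX i) k0 (@Xge i) (mFw i w) mB Brad EL BL (etrans Em fB).
rewrite -/(D i w) => h.
have Df : D i w \is a fin_num.
  rewrite ge0_fin_numE//; apply: (@le_lt_trans _ _ (mn (eball L))); last exact: eball_measure_fin.
  apply: le_measure; rewrite ?inE//.
  - apply: measurableD => //; apply: measurable_lt_fun.
    exact: mFw.
  - exact: measurable_eball.
  - by apply: subset_trans EL; exact: subDsetl.
move: h; rewrite -(fineK Df); set r := fine _ => h.
apply: (@le_trans _ _ (\int[P]_w' G (w, X i w') + (k%:E * (r%:E * r%:E) + (k * s ^+ 2)%:E))).
  rewrite leeD2l// -!EFinM -EFinD lee_fin -subr_ge0.
  rewrite (_ : _ - _ = k * (r - s) ^+ 2)%R; last by ring.
  by rewrite mulr_ge0// sqr_ge0.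
by rewrite addeA leeD2r.
Qed.

End recursion.
End random_polarization.
(** Choosing s = e i would give e (i + 1) <= e i - k (e i)^2. Choosing s as the bound already proved
    gives an estimate monotone in e i, so that the induction bound can be substituted. *)
Lemma quadratic_recursion_le (R : realFieldType) (k : R) (e : nat -> R) : 0 < k ->
  (forall i, 0 <= e i) ->
  (forall i s, 0 <= s -> e i.+1 + 2 * k * s * e i <= e i + k * s ^+ 2) ->
  forall i, (0 < i)%N -> e i <= (k * i%:R)^-1.
Proof.
move=> k0 e0 erec; have k_neq0 := lt0r_neq0 k0.
(* For s = 1 / (2 k) the terms e i cancel: after one step the bound no longer depends on the initial
   value, and it settles the indices 1 and 2. *)
have e4 i : e i.+1 <= (4 * k)^-1.
  have s0 : 0 <= (2 * k)^-1 by rewrite invr_ge0 mulr_ge0// ltW.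
  have := erec i _ s0.
  rewrite (_ : 2 * k * (2 * k)^-1 = 1); last by field.
  rewrite (_ : k * (2 * k)^-1 ^+ 2 = (4 * k)^-1); last by field.
  by rewrite mul1r addrC lerD2l.
case=> // i _; elim: i => [|[|i] IH].
- by rewrite (le_trans (e4 0%N))// lef_pV2 ?posrE ?mulr_gt0//; lra.
- rewrite (le_trans (e4 1%N))// lef_pV2 ?posrE ?mulr_gt0//; nra.
have x2 : 2 <= i.+2%:R :> R by rewrite ler_nat.
have -> : i.+3%:R = i.+2%:R + 1 :> R by rewrite natr1.
move: (i.+2%:R) x2 IH => x x2 IH.
have x0 : x != 0 by rewrite gt_eqF//; lra.
have x10 : x + 1 != 0 by rewrite gt_eqF//; lra.
(* With s = 1 / (k x), the coefficient of the previous term is 1 - 2 / x, nonnegative since x >=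
   2. *)
have s0 : 0 <= (k * x)^-1 by rewrite invr_ge0 mulr_ge0 ?(ltW k0)//; lra.
have := erec i.+2 _ s0.
rewrite (_ : 2 * k * (k * x)^-1 = 2 / x); last by field; rewrite ?x0 ?k_neq0.
rewrite (_ : k * (k * x)^-1 ^+ 2 = (k * x ^+ 2)^-1); last by field; rewrite ?x0 ?k_neq0.
move=> h; have h1 : e i.+3 <= e i.+2 * (1 - 2 / x) + (k * x ^+ 2)^-1 by lra.
apply: (le_trans h1).
apply: (@le_trans _ _ ((k * x)^-1 * (1 - 2 / x) + (k * x ^+ 2)^-1)).
  by rewrite lerD2r ler_wpM2r// subr_ge0 ler_pdivrMr ?mul1r; lra.
(* The slack is 1 / (k (x + 1)) - (x - 1) / (k x^2) = 1 / (k x^2 (x + 1)). *)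
rewrite -subr_ge0 (_ : _ - _ = (k * x ^+ 2 * (x + 1))^-1); last first.
  by field; rewrite ?x0 ?x10 ?k_neq0.
by rewrite invr_ge0 !mulr_ge0 ?ltW// ?exprn_ge0//; lra.
Qed.

(** * The symmetric decreasing rearrangement *)

Section symmetrization.
Context {R : realType} {n : nat}.
Local Notation mn := (lebesgue_rV R n.+1).
Let b := fine (mn (eball 1)).

Let b_gt0 : 0 < b.
Proof. by rewrite fine_gt0// eball_measure_gt0// eball_measure_fin. Qed.

Lemma eball_measureE (r : R) : 0 <= r -> mn (eball r) = (r ^+ n.+1 * b)%:E.
Proof.
rewrite le_eqVlt => /orP[/eqP <-|r0].
  rewrite exprS !mul0r (_ : eball 0 = set0) ?measure0//.
  by apply/seteqP; split => x //; rewrite /eball/= ltNge enorm_ge0.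
have bE : b%:E = mn (eball 1) by rewrite fineK// ge0_fin_numE// eball_measure_fin.
rewrite EFinM bE !rV_measure_indic; try exact: measurable_eball.
rewrite -(@integral_rV_scale _ _ _ r) ?gt_eqF//; last first.
  by apply/measurable_EFinP; apply: measurable_indic; exact: measurable_eball.
rewrite gtr0_norm//; congr (_ * _)%E; apply: eq_integral => x _.
rewrite !indicE !in_eball enormZ gtr0_norm//.
by rewrite -[X in _ < X]mulr1 ltr_pM2l.
Qed.

Lemma eball_measure_le (r r' : R) : 0 <= r -> 0 <= r' ->
  (mn (eball r) <= mn (eball r'))%E -> r <= r'.
Proof.
by move=> r0 r'0; rewrite !eball_measureE// lee_fin ler_pM2r// ler_pXn2r.
Qed.

(** The radius is chosen by [xget]; the witness (m(A) / b)^(1 / (n + 1)) shows that the choice meets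
    its specification. *)
Lemma symm_setE (A : set 'rV[R]_n.+1) : (mn A < +oo)%E ->
  exists r, [/\ 0 <= r, symm_set A = eball r & mn (eball r) = mn A].
Proof.
move=> Aoo; rewrite /symm_set; set Q := [set r | _].
suff /xgetPex : Q !=set0 by move=> /(_ 0) [? ?]; exists (xget 0 Q).
have Af : mn A \is a fin_num by rewrite ge0_fin_numE.
have q0 : 0 <= fine (mn A) / b by rewrite divr_ge0 ?fine_ge0// ltW.
exists ((fine (mn A) / b) `^ n.+1%:R^-1); split; first exact: powR_ge0.
rewrite eball_measureE ?powR_ge0// -powR_mulrn ?powR_ge0// -powRrM mulVf// powRr1//.
by rewrite divfK ?gt_eqF// fineK.
Qed.

Variables (L : R) (f : 'rV[R]_n.+1 -> R).
Hypothesis L0 : 0 < L.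
Hypothesis mf : measurable_fun [set: 'rV[R]_n.+1] f.
Hypothesis fL : forall x, ~ eball L x -> f x = 0.

Lemma superlevel_eball t : 0 <= t -> [set x | t < f x] `<=` eball L.
Proof.
move=> t0 x /= tx; apply: contrapT => /fL fx0.
by move: tx; rewrite fx0 ltNge t0.
Qed.

Let A t := [set x | t < f x].

Let A_fin t : 0 <= t -> (mn (A t) < +oo)%E.
Proof.
move=> t0; apply: (le_lt_trans _ (eball_measure_fin _ L)).
apply: le_measure; rewrite ?inE; [exact: measurable_lt_fun|exact: measurable_eball|].
exact: superlevel_eball.
Qed.

Let le_A s t : s <= t -> A t `<=` A s.
Proof. by move=> st x; exact: le_lt_trans. Qed.

Let symm_set_sub s t : 0 <= s -> s <= t -> symm_set (A t) `<=` symm_set (A s).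
Proof.
move=> s0 st; have t0 := le_trans s0 st.
have [r [r0 -> rE]] := symm_setE (A_fin s0).
have [r' [r'0 -> r'E]] := symm_setE (A_fin t0).
have r'r : r' <= r.
  apply: eball_measure_le => //; rewrite rE r'E; apply: le_measure; rewrite ?inE.
  - exact: measurable_lt_fun.
  - exact: measurable_lt_fun.
  - exact: le_A.
by move=> x /= xr'; exact: lt_le_trans r'r.
Qed.

(** The supremum exceeds t when some level above t is admissible, and the balls shrink as the level
    grows. Measurability, radial symmetry and measure of {f^* > t} are all read off this increasing
    union of balls. *)
Let level_seq t : 0 <= t ->
  [set x | (t%:E < symm_fun f x)%E] = \bigcup_k symm_set (A (t + k.+1%:R^-1)).
Proof.
move=> t0; apply/seteqP; split => x /=.
  rewrite /symm_fun lt_max => /orP[|/ereal_sup_gtP]; first by rewrite lte_fin ltNge t0.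
  move=> [_ [u [u0 ux] <-]]; rewrite lte_fin => tu.
  have [k tk] := ltr_add_invr tu; exists k; first by [].
  by apply: symm_set_sub ux; [rewrite addr_ge0|exact: ltW].
move=> [k _ xk]; rewrite /symm_fun lt_max; apply/orP; right; apply/ereal_sup_gtP.
exists (t + k.+1%:R^-1)%:E; last by rewrite lte_fin ltrDl.
by exists (t + k.+1%:R^-1) => //; split => //; rewrite ltr_wpDl.
Qed.

Let measurable_symm_set t : 0 <= t -> measurable (symm_set (A t)).
Proof.
by move=> t0; have [r [_ -> _]] := symm_setE (A_fin t0); exact: measurable_eball.
Qed.

Let pos_level t k : 0 <= t -> 0 <= t + k.+1%:R^-1 :> R.
Proof. by move=> t0; rewrite addr_ge0. Qed.

Lemma symm_fun_ge0 x : (0 <= symm_fun f x)%E.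
Proof. by rewrite /symm_fun le_max lexx. Qed.

Lemma measurable_symm_level t : 0 <= t ->
  measurable [set x | (t%:E < symm_fun f x)%E].
Proof.
move=> t0; rewrite level_seq//; apply: bigcupT_measurable => k.
apply: measurable_symm_set; exact: pos_level.
Qed.

Lemma measurable_symm_fun : measurable_fun [set: 'rV[R]_n.+1] (symm_fun f).
Proof.
move=> _; apply: (measurability _ (ErealGenOInfty.measurableE R)) => //.
move=> /= _ [_ [t ->]] <-; apply: measurableI => //; rewrite preimage_itvoy.
have [t0|t0] := leP 0 t; first exact: measurable_symm_level.
rewrite (_ : [set _ | _] = setT)//; apply/seteqP; split => x //= _.
by rewrite (lt_le_trans _ (symm_fun_ge0 x))// lte_fin.
Qed.

Lemma symm_level_radial t x y : 0 <= t -> (t%:E < symm_fun f y)%E ->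
  enorm x <= enorm y -> (t%:E < symm_fun f x)%E.
Proof.
move=> t0; have /seteqP[h1 h2] := level_seq t0.
move=> /h1[k _ ky] xy; apply: h2; exists k => //.
have [r [_ E _]] := symm_setE (A_fin (pos_level k t0)).
by move: ky; rewrite E /eball/=; exact: le_lt_trans.
Qed.

(** Each ball of the union has the measure of a superlevel set contained in B_L, so its radius is at
    most L. *)
Lemma symm_level_eball t : 0 <= t -> [set x | (t%:E < symm_fun f x)%E] `<=` eball L.
Proof.
move=> t0; rewrite level_seq//; apply: bigcup_sub => k _.
have [r [r0 -> rE]] := symm_setE (A_fin (pos_level k t0)).
suff rL : r <= L by move=> x /= xr; exact: lt_le_trans rL.
apply: eball_measure_le => //; first exact: ltW.
rewrite rE; apply: le_measure; rewrite ?inE; [exact: measurable_lt_fun|exact: measurable_eball|].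
by apply: superlevel_eball; exact: pos_level.
Qed.

(** Both sets are increasing unions whose terms have equal measures, by construction of [symm_set];
    continuity from below concludes. *)
Lemma symm_level_measure t : 0 <= t ->
  mn [set x | t < f x] = mn [set x | (t%:E < symm_fun f x)%E].
Proof.
move=> t0; rewrite level_seq//.
have -> : [set x | t < f x] = \bigcup_k A (t + k.+1%:R^-1).
  apply/seteqP; split => x /=.
    by move=> /ltr_add_invr[k tk]; exists k.
  by move=> [k _]; apply: le_lt_trans; rewrite lerDl.
have le_seq i j : (i <= j)%N -> t + j.+1%:R^-1 <= t + i.+1%:R^-1 :> R.
  by move=> ij; rewrite lerD2l lef_pV2 ?posrE// ler_nat.
have cA : mn \o (fun k => A (t + k.+1%:R^-1)) @ \oo --> mn (\bigcup_k A (t + k.+1%:R^-1)).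
  apply: nondecreasing_cvg_mu => [k||i j ij].
  - exact: measurable_lt_fun.
  - by apply: bigcupT_measurable => k; exact: measurable_lt_fun.
  - by apply/subsetPset; apply: le_A; exact: le_seq.
have cS : mn \o (fun k => symm_set (A (t + k.+1%:R^-1))) @ \oo -->
    mn (\bigcup_k symm_set (A (t + k.+1%:R^-1))).
  apply: nondecreasing_cvg_mu => [k||i j ij].
  - apply: measurable_symm_set; exact: pos_level.
  - by apply: bigcupT_measurable => k; apply: measurable_symm_set; exact: pos_level.
  - by apply/subsetPset; apply: symm_set_sub; [exact: pos_level|exact: le_seq].
apply: (cvg_unique _ cA) => //; rewrite (_ : _ \o _ =
  mn \o (fun k => symm_set (A (t + k.+1%:R^-1))))//.
by apply/funext => k /=; have [r [_ -> ->]//] := symm_setE (A_fin (pos_level k t0)).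
Qed.

End symmetrization.
(** * Integration over the levels *)

Section layer_cake.
Context {R : realType}.
Local Notation mu := (@lebesgue_measure R).
Local Open Scope ereal_scope.

Lemma measurable_lt_set d (S : measurableType d) (u v : S -> \bar R) :
  measurable_fun [set: S] u -> measurable_fun [set: S] v ->
  measurable [set z | u z < v z].
Proof. by move=> mu' mv; rewrite -[X in measurable X]setTI; exact: measurable_lte. Qed.

Lemma lebesgue_measure_co (a b : R) :
  mu [set t : measurableTypeR R | (a <= t)%R /\ (t < b)%R] = (Num.max (b - a) 0)%:E.
Proof.
rewrite (_ : [set t | _] = [set` `[a, b[%R]); last first.
  by apply/seteqP; split => t /=; rewrite in_itv/= => /andP.
rewrite lebesgue_measure_itv/= lte_fin; case: ltP => ab.
  by rewrite -EFinD; congr EFin; apply/esym/max_idPl; rewrite subr_ge0 ltW.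
by congr EFin; apply/esym/max_idPr; rewrite subr_le0.
Qed.

(** The levels that separate a from b fill the interval between them. The value b is extended
    because f^* may be infinite at 0. *)
Lemma abse_sub_layers (a : R) (b : \bar R) : (0 <= a)%R -> 0 <= b ->
  `|a%:E - b| =
  mu [set t : measurableTypeR R | [/\ (0 <= t)%R, (t < a)%R & ~ t%:E < b]] +
  mu [set t : measurableTypeR R | [/\ (0 <= t)%R, t%:E < b & ~ (t < a)%R]].
Proof.
move=> a0; case: b => [b b0|_|//]; last first.
  rewrite [X in mu X + _](_ : _ = set0); last first.
    by apply/seteqP; split => t //= [_ _]; rewrite ltry.
  rewrite measure0 add0e (_ : [set t | _] = [set` `[a, +oo[%R]); last first.
    apply/seteqP; split => t /=; rewrite in_itv/= andbT.
      by move=> [_ _ /negP]; rewrite -leNgt.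
    by move=> at_; split; [exact: le_trans at_|rewrite ltry|apply/negP; rewrite -leNgt].
  by rewrite lebesgue_measure_itv/= ltry.
rewrite lee_fin in b0.
rewrite [X in mu X + _](_ : _ = [set t | (b <= t)%R /\ (t < a)%R]); last first.
  apply/seteqP; split => t /=; rewrite lte_fin.
    by move=> [_ ta /negP]; rewrite -leNgt.
  by move=> [bt ta]; split => //; [exact: le_trans bt|apply/negP; rewrite -leNgt].
rewrite [X in _ + mu X](_ : _ = [set t | (a <= t)%R /\ (t < b)%R]); last first.
  apply/seteqP; split => t /=; rewrite lte_fin.
    by move=> [_ ta /negP]; rewrite -leNgt.
  by move=> [bt ta]; split => //; [exact: le_trans bt|apply/negP; rewrite -leNgt].
rewrite !lebesgue_measure_co -!EFinD /= ; congr EFin.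
have [ab|ab] := leP b a.
  rewrite ger0_norm ?subr_ge0// (max_idPl _) ?subr_ge0//.
  by rewrite (max_idPr _) ?subr_le0// addr0.
rewrite ltr0_norm ?subr_lt0// (max_idPr _) ?subr_le0 ?ltW//.
by rewrite (max_idPl _) ?subr_ge0 ?ltW// add0r opprB.
Qed.

Context d (T : measurableType d) (m : {sigma_finite_measure set T -> \bar R}).

(** At each level the two one-sided differences have the same measure, whence the factor 2; negative
    levels contribute nothing. *)
Lemma integral_abs_layers (g : T -> R) (s : T -> \bar R) :
  measurable_fun [set: T] g -> measurable_fun [set: T] s ->
  (forall x, 0 <= g x)%R -> (forall x, 0 <= s x) ->
  (forall t, (0 <= t)%R -> m ([set x | (t < g x)%R] `\` [set x | t%:E < s x]) =
                      m ([set x | t%:E < s x] `\` [set x | (t < g x)%R])) ->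
  \int[m]_x `|(g x)%:E - s x| =
  \int[mu]_t (2%:E * m [set x | [/\ (0 <= t)%R, (t < g x)%R & ~ t%:E < s x]]).
Proof.
move=> mg ms g0 s0 E.
pose Q1 (x : T) (t : measurableTypeR R) := [/\ (0 <= t)%R, (t < g x)%R & ~ t%:E < s x].
pose Q2 (x : T) (t : measurableTypeR R) := [/\ (0 <= t)%R, t%:E < s x & ~ (t < g x)%R].
have mt : measurable_fun setT (fun z : T * measurableTypeR R => (z.2 : R)%:E).
  by apply/measurable_EFinP; exact: measurable_snd.
have mgz : measurable_fun setT (fun z : T * measurableTypeR R => (g z.1)%:E).
  by apply/measurable_EFinP; apply: measurableT_comp => //; exact: measurable_fst.
have msz : measurable_fun setT (fun z : T * measurableTypeR R => s z.1).
  by apply: measurableT_comp => //; exact: measurable_fst.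
have m0 : measurable [set z : T * measurableTypeR R | (0 <= z.2)%R].
  rewrite (_ : [set z | _] = ~` [set z : T * measurableTypeR R | (z.2 : R)%:E < 0%:E]).
    by apply: measurableC; apply: measurable_lt_set => //; exact: measurable_cst.
  by apply/seteqP; split => z /=; rewrite lte_fin leNgt => /negP.
have mQ1 : measurable [set z : T * measurableTypeR R | Q1 z.1 z.2].
  rewrite (_ : [set z | _] = [set z | (0 <= z.2)%R] `&`
     [set z | (z.2 : R)%:E < (g z.1)%:E] `&` ~` [set z | (z.2 : R)%:E < s z.1]).
    apply: measurableI; last by apply: measurableC; exact: measurable_lt_set.
    by apply: measurableI => //; exact: measurable_lt_set.
  by apply/seteqP; split => z /=; rewrite /Q1 lte_fin => -[] // [].
have mQ2 : measurable [set z : T * measurableTypeR R | Q2 z.1 z.2].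
  rewrite (_ : [set z | _] = [set z | (0 <= z.2)%R] `&`
     [set z | (z.2 : R)%:E < s z.1] `&` ~` [set z | (z.2 : R)%:E < (g z.1)%:E]).
    apply: measurableI; last by apply: measurableC; exact: measurable_lt_set.
    by apply: measurableI => //; exact: measurable_lt_set.
  by apply/seteqP; split => z /=; rewrite /Q2 lte_fin => -[] // [].
have swap (Q : T -> measurableTypeR R -> Prop) :
    measurable [set z : T * measurableTypeR R | Q z.1 z.2] ->
    measurable [set z : measurableTypeR R * T | Q z.2 z.1].
  move=> mQ; have : measurable_fun setT (fun z : measurableTypeR R * T => (z.2, z.1)).
    by apply/measurable_fun_pairP; split; [exact: measurable_snd|exact: measurable_fst].
  by move=> /(_ measurableT _ mQ); rewrite setTI.
transitivity (\int[m]_x (mu [set t | Q1 x t] + mu [set t | Q2 x t])).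
  by apply: eq_integral => x _; rewrite abse_sub_layers.
rewrite ge0_integralD//; try exact: measurable_measure_section.
rewrite (@integral_measure_section _ _ _ _ _ m mu Q1 mQ1).
rewrite (@integral_measure_section _ _ _ _ _ m mu Q2 mQ2).
have mS1 := @measurable_measure_section _ _ _ _ _ m (fun t x => Q1 x t) (swap _ mQ1).
have mS2 := @measurable_measure_section _ _ _ _ _ m (fun t x => Q2 x t) (swap _ mQ2).
rewrite -(ge0_integralD _ measurableT (fun _ _ => measure_ge0 _ _) mS1
  (fun _ _ => measure_ge0 _ _) mS2).
apply: eq_integral => t _; rewrite -[2%R]/(1 + 1)%R EFinD ge0_muleDl// mul1e.
congr (_ + _); have [t0|t0] := leP 0%R t; last first.
  congr (m _); apply/seteqP; split => x /=; rewrite /Q2.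
    by case; rewrite leNgt t0.
  by case; rewrite leNgt t0.
rewrite (_ : [set x | Q2 x t] = [set x | t%:E < s x] `\` [set x | (t < g x)%R]); last first.
  by apply/seteqP; split => x /= -[].
apply: etrans (esym (E t t0)) _; congr (m _).
by apply/seteqP; split => x /= -[].
Qed.

(** For fixed x the levels in question form [S, f x), of length (f x - S)^+. *)
Lemma integral_tail (f : T -> R) (S : R) : measurable_fun [set: T] f ->
  \int[mu]_t m [set x | (S <= t)%R /\ (t < f x)%R] =
  \int[m]_x (Num.max (f x - S) 0)%:E.
Proof.
move=> mf; pose Q (t : measurableTypeR R) (x : T) := (S <= t)%R /\ (t < f x)%R.
have mQ : measurable [set z : measurableTypeR R * T | Q z.1 z.2].
  rewrite (_ : [set z | _] = ~` [set z : measurableTypeR R * T | (z.1 : R)%:E < S%:E] `&`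
      [set z | (z.1 : R)%:E < (f z.2)%:E]).
    apply: measurableI; [apply: measurableC|]; apply: measurable_lt_set.
    - by apply/measurable_EFinP; exact: measurable_fst.
    - exact: measurable_cst.
    - by apply/measurable_EFinP; exact: measurable_fst.
    - by apply/measurable_EFinP; apply: measurableT_comp => //; exact: measurable_snd.
  apply/seteqP; split => z /=; rewrite /Q !lte_fin.
    by move=> [Sz zf]; split => //; apply/negP; rewrite -leNgt.
  by move=> [/negP]; rewrite -leNgt.
rewrite (@integral_measure_section _ _ _ _ _ mu m Q mQ).
by apply: eq_integral => x _; exact: lebesgue_measure_co.
Qed.

End layer_cake.

(** * Expected L^1-distance, split at a level S *)

Section rate.
Context {R : realType} {n : nat}.
Local Notation mn := (lebesgue_rV R n.+1).
Local Notation mu := (@lebesgue_measure R).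
Context d (T : measurableType d) (P : probability T R) (X : nat -> T -> 'rV[R]_n.+1).
Hypothesis mX : forall i, measurable_fun [set: T] (X i).
Hypothesis indepX : mutually_independent P X.
Variables (L k : R).
Hypothesis L0 : 0 < L.
Hypothesis k0 : 0 < k.
Hypothesis Xge : forall i (x : 'rV[R]_n.+1) (V : set 'rV[R]_n.+1),
  measurable V -> V `<=` eball L -> enorm x < L ->
  (forall y, V y -> enorm y != enorm x) ->
  (k%:E * mn V <= P [set w | V (bisect (X i w) x)])%E.
Variable (f : 'rV[R]_n.+1 -> R).
Hypothesis mf : measurable_fun [set: 'rV[R]_n.+1] f.
Hypothesis f0 : forall x, 0 <= f x.
Hypothesis fL : forall x, ~ eball L x -> f x = 0.
Local Open Scope ereal_scope.

Let F i w := polarize_seq (fun j => bisect (X j w)) i f.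
Let B t := [set x | t%:E < symm_fun f x].
Let D t i w := mn ([set x | (t < F i w x)%R] `\` B t).

Let F_ge0 i w x : (0 <= F i w x)%R.
Proof.
rewrite /F; elim: i x => [|i IH] x //=; rewrite polarizeE.
by case: ifP => _; [rewrite le_max IH|case: ifP => _; rewrite ?le_min ?IH].
Qed.

Let fine_measure (A : set 'rV[R]_n.+1) : measurable A -> A `<=` eball L -> mn A < +oo.
Proof.
move=> mA AL; apply: (le_lt_trans _ (eball_measure_fin n.+1 L)).
by apply: le_measure; rewrite ?inE//; exact: measurable_eball.
Qed.

Section level.
Variable t : R.
Hypothesis t0 : (0 <= t)%R.

Let mB : measurable (B t). Proof. exact: (measurable_symm_level mf fL). Qed.

Let mF d' (S : measurableType d') i (u : S -> T) (v : S -> 'rV[R]_n.+1) :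
  measurable_fun [set: S] u -> measurable_fun [set: S] v ->
  measurable_fun [set: S] (fun z => F i (u z) (v z)).
Proof.
move=> mu' mv; apply: (@measurable_polarize_seq _ _ _ _ (fun j z => X j (u z))) => // j _.
exact: measurableT_comp (mX j) mu'.
Qed.

Let mA i w : measurable [set x | (t < F i w x)%R].
Proof. by apply: measurable_lt_fun; apply: (@mF _ _ i (fun=> w) id). Qed.

Let mD i : measurable_fun [set: T] (D t i).
Proof. exact: (measurable_excess mX t mf mB). Qed.

Let fL' := superlevel_eball fL t0.

(** Polarization preserves the measure of the superlevel set. This crude bound makes the expectation
    finite and serves for the levels above S. *)
Lemma expected_excess_level_le i : \int[P]_w D t i w <= mn [set x | (t < f x)%R].
Proof.
rewrite -[leRHS](integral_probability_cst P); apply: ge0_le_integral => //.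
move=> w _ /=; have [<- _] := polarize_seq_measure mX mf fL' i w.
by apply: le_measure; rewrite ?inE; [exact: measurableD|exact: mA|exact: subDsetl].
Qed.

Lemma expected_excess_rate i : (0 < i)%N ->
  \int[P]_w D t i w <= ((k * i%:R)^-1)%:E.
Proof.
have Df j : \int[P]_w D t j w \is a fin_num.
  rewrite ge0_fin_numE; last exact: integral_ge0.
  apply: (le_lt_trans (expected_excess_level_le j)); apply: fine_measure => //.
  exact: measurable_lt_fun.
move=> i0; rewrite -(fineK (Df i)) lee_fin.
apply: (quadratic_recursion_le (e := fun j => fine (\int[P]_w D t j w))) => // [j|j s s0].
  by apply: fine_ge0; exact: integral_ge0.
have Brad x y : B t y -> (enorm x <= enorm y)%R -> B t x.
  exact: (symm_level_radial mf fL t0).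
have h : \int[P]_w D t j.+1 w + (2 * k * s)%:E * \int[P]_w D t j w <=
    \int[P]_w D t j w + (k * s ^+ 2)%:E.
  exact: (expected_excess_le mX indepX (ltW k0) Xge mf mB Brad fL'
    (symm_level_eball L0 mf fL t0) (symm_level_measure mf fL t0) j s0).
have real (a b : \bar R) (c c' : R) : a \is a fin_num -> b \is a fin_num ->
    a + c%:E * b <= b + c'%:E -> (fine a + c * fine b <= fine b + c')%R.
  by case: a => [a| |]//; case: b.
exact: real (Df j.+1) (Df j) h.
Qed.

End level.

Let N i w := \int[mn]_x `|(F i w x)%:E - symm_fun f x|.
(** The condition 0 <= t is part of the set, so that levels are integrated over the whole line. *)
Let H i w (t : measurableTypeR R) :=
  mn [set x | [/\ (0 <= t)%R, (t < F i w x)%R & ~ t%:E < symm_fun f x]].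

Let mF i w : measurable_fun [set: 'rV[R]_n.+1] (F i w).
Proof.
by apply: (@measurable_polarize_seq _ _ _ _ (fun j _ => X j w) f id).
Qed.

Let mS := measurable_symm_fun mf fL.

Let NE i w : N i w = \int[mu]_t (2%:E * H i w t).
Proof.
apply: integral_abs_layers => // [x|t t0]; first exact: symm_fun_ge0.
have [E FL] := polarize_seq_measure mX mf (superlevel_eball fL t0) i w.
apply/esym/measure_setD_eq.
- exact: measurable_lt_fun.
- exact: (measurable_symm_level mf fL t0).
- by rewrite E; exact: (symm_level_measure mf fL t0).
- by apply: fine_measure FL; exact: measurable_lt_fun (mF i w).
Qed.

Let mH i : measurable_fun [set: T * measurableTypeR R] (fun z => H i z.1 z.2).
Proof.
apply: (@measurable_measure_section _ _ _ _ _ mn (fun z x =>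
  [/\ (0 <= (z.2 : R))%R, (z.2 < F i z.1 x)%R & ~ (z.2 : R)%:E < symm_fun f x])).
pose U := (T * measurableTypeR R * 'rV[R]_n.+1)%type.
have m11 : measurable_fun [set: U] (fun z => z.1.1).
  by apply: measurableT_comp; [exact: measurable_fst|exact: measurable_fst].
have m12 : measurable_fun [set: U] (fun z => (z.1.2 : R)%:E).
  apply/measurable_EFinP.
  by apply: measurableT_comp; [exact: measurable_snd|exact: measurable_fst].
have mFz : measurable_fun [set: U] (fun z => (F i z.1.1 z.2)%:E).
  apply/measurable_EFinP; apply: (@measurable_polarize_seq _ _ _ _
    (fun j (z : U) => X j z.1.1) f snd) => // j _.
  exact: measurableT_comp (mX j) m11.
have mSz : measurable_fun [set: U] (fun z => symm_fun f z.2).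
  by apply: measurableT_comp => //; exact: measurable_snd.
rewrite (_ : [set z | _] = ~` [set z : U | (z.1.2 : R)%:E < 0%:E] `&`
   [set z : U | (z.1.2 : R)%:E < (F i z.1.1 z.2)%:E] `&`
   ~` [set z : U | (z.1.2 : R)%:E < symm_fun f z.2]).
  apply: measurableI; last by apply: measurableC; exact: measurable_lt_set.
  apply: measurableI; last exact: measurable_lt_set.
  by apply: measurableC; apply: measurable_lt_set => //; exact: measurable_cst.
apply/seteqP; split => z /=; rewrite !lte_fin leNgt.
  by move=> [/negP].
by move=> [[/negP]].
Qed.

Let H_level i t : (0 <= t)%R -> \int[P]_w H i w t = \int[P]_w D t i w.
Proof.
move=> t0; apply: eq_integral => w _; congr (mn _).
by apply/seteqP; split => x /= -[].
Qed.

Lemma expected_distance_le i (S : R) : (0 < i)%N -> (0 <= S)%R ->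
  \int[P]_w N i w <= 2%:E * ((S / (k * i%:R))%:E +
    \int[mn]_x (Num.max (f x - S) 0)%:E).
Proof.
move=> i0 S0.
have H0 z : 0 <= H i z.1 z.2 by [].
have mHt : measurable_fun [set: measurableTypeR R] (fun t => \int[P]_w H i w t).
  by apply: (@measurable_fun_fubini_tonelli_G _ _ _ _ _ P _ (mH i)).
have -> : \int[P]_w N i w = 2%:E * \int[mu]_t \int[P]_w H i w t.
  under eq_integral do rewrite NE.
  have E w : \int[mu]_t (2%:E * H i w t) = 2%:E * \int[mu]_t H i w t.
    by rewrite ge0_integralZl//; exact: measurableT_comp (mH i) (pair1_measurable w).
  under eq_integral do rewrite E.
  rewrite ge0_integralZl//; last 2 first.
  - exact: (measurable_fun_fubini_tonelli_F _ (mH i)).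
  - by move=> w _; exact: integral_ge0.
  by rewrite (fubini_tonelli _ (mH i)).
apply: lee_wpmul2l; first by rewrite lee_fin.
pose I : set (measurableTypeR R) := [set` `[0%R, S[%R].
have mI : measurable I by exact: measurable_itv.
have IE : mu I = S%:E.
  rewrite lebesgue_measure_itv/= lte_fin.
  case: ltP => [_|S0']; first by rewrite oppr0 adde0.
  by congr EFin; apply/le_anti/andP.
pose c := ((k * i%:R)^-1)%R.
have c0 : (0 <= c)%R by rewrite invr_ge0 mulr_ge0// ltW.
have mtail : measurable_fun [set: measurableTypeR R]
    (fun t => mn [set x | (S <= t)%R /\ (t < f x)%R]).
  apply: (@measurable_measure_section _ _ _ _ _ mn (fun (t : measurableTypeR R) x =>
    (S <= t)%R /\ (t < f x)%R)).
  pose V := (measurableTypeR R * 'rV[R]_n.+1)%type.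
  have m1 : measurable_fun [set: V] (fun z => (z.1 : R)%:E).
    by apply/measurable_EFinP; exact: measurable_fst.
  rewrite (_ : [set z | _] = ~` [set z : V | (z.1 : R)%:E < S%:E] `&`
      [set z : V | (z.1 : R)%:E < (f z.2)%:E]).
    apply: measurableI; [apply: measurableC|]; apply: measurable_lt_set => //.
    by apply/measurable_EFinP; apply: measurableT_comp => //; exact: measurable_snd.
  apply/seteqP; split => z /=; rewrite !lte_fin leNgt.
    by move=> [/negP].
  by move=> [/negP].
rewrite -integral_tail//.
(* Both terms of the bound become integrals over levels, so that the comparison is made level by
   level. *)
have -> : (S / (k * i%:R))%:E = \int[mu]_t ((\1_I t)%:E * c%:E).
  rewrite ge0_integralZr//; last by apply/measurable_EFinP; exact: measurable_indic.
  rewrite integral_indic// setIT EFinM; congr (_ * _); exact/esym.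
rewrite -ge0_integralD//; last 2 first.
- by move=> t _; rewrite mule_ge0// lee_fin.
- apply: emeasurable_funM; last exact: measurable_cst.
  by apply/measurable_EFinP; exact: measurable_indic.
apply: ge0_le_integral => //.
- by move=> t _; exact: integral_ge0.
- apply: emeasurable_funD => //.
  apply: emeasurable_funM; last exact: measurable_cst.
  by apply/measurable_EFinP; exact: measurable_indic.
move=> t _; have [t0|t0] := leP 0%R t; last first.
  have -> : \int[P]_w H i w t = 0.
    apply: integral0_eq => w _; rewrite /H [X in mn X](_ : _ = set0) ?measure0//.
    by apply/seteqP; split => x //= -[]; rewrite leNgt t0.
  by rewrite adde_ge0// mule_ge0// lee_fin.
rewrite H_level//; have [tS|St] := ltP t S.
  rewrite (@le_trans _ _ c%:E)//; first exact: expected_excess_rate.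
  have tI : I t by rewrite /I/= in_itv/= t0 tS.
  by rewrite indicE mem_set// mul1e leeDl.
rewrite (le_trans (expected_excess_level_le t0 i))// -[leLHS]add0e leeD//.
  by rewrite mule_ge0// lee_fin.
rewrite (_ : [set x | _ /\ _] = [set x | (t < f x)%R])//.
by apply/seteqP; split => x /= => [[]|].
Qed.

End rate.

(** * Mass of f above a level *)

Section tail.
Context {R : realType} d (T : measurableType d).
Variables (m : {measure set T -> \bar R}) (f : T -> R).
Hypothesis mf : measurable_fun [set: T] f.
Hypothesis f0 : forall x, 0 <= f x.

Let mtail S : measurable_fun [set: T] (fun x => (Num.max (f x - S) 0)%:E).
Proof.
apply/measurable_EFinP; apply: measurable_maxr; last exact: measurable_cst.
by apply: measurable_funB => //; exact: measurable_cst.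
Qed.

(** M is the essential supremum. The norm at +oo is defined as that supremum only for a nonzero
    measure. *)
Lemma tail_eq0 : (0 < m setT)%E -> finite_norm m +oo%E f ->
  exists2 M, 0 <= M & (\int[m]_x (Num.max (f x - M) 0)%:E = 0)%E.
Proof.
move=> mT; rewrite /finite_norm unlock mT => supf.
have sup0 : (0 <= ess_sup m (abse \o (EFin \o f)))%E.
  by apply: ess_sup_gee => //; apply: nearW => x /=.
have supE : (fine (ess_sup m (abse \o (EFin \o f))))%:E = ess_sup m (abse \o (EFin \o f)).
  by rewrite fineK// ge0_fin_numE.
exists (fine (ess_sup m (abse \o (EFin \o f)))); first exact: fine_ge0.
rewrite -[RHS](integral0 m setT); apply: ge0_ae_eq_integral => //.
- by move=> x _; rewrite lee_fin le_max lexx orbT.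
apply: filterS (ess_sup_ge m (abse \o (EFin \o f))) => x fx _.
congr EFin; apply/max_idPr; rewrite subr_le0 -lee_fin supE//.
by apply: le_trans fx; rewrite /= lee_fin ler_norm.
Qed.

(** Where f > S, write f = f^p f^(1-p); since 1 - p < 0, the last factor is at most S^(1-p). K is
    the integral of f^p. *)
Lemma tail_le (p : R) : 1 < p -> finite_norm m p%:E f ->
  exists2 K, 0 <= K & forall S, 0 < S ->
    (\int[m]_x (Num.max (f x - S) 0)%:E <= (K * S `^ (1 - p))%:E)%E.
Proof.
move=> p1; rewrite /finite_norm => Nf.
have p0 : 0 < p by rewrite (lt_trans _ p1).
have If : (\int[m]_x (f x `^ p)%:E < +oo)%E.
  have <- : ('N[m]_p%:E[EFin \o f] `^ p = \int[m]_x (f x `^ p)%:E)%E.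
    rewrite (poweR_Lnorm m (EFin \o f) (lt0r_neq0 p0)).
    by apply: eq_integral => x _ /=; rewrite ger0_norm.
  have Nfin : ('N[m]_p%:E[EFin \o f])%E \is a fin_num.
    rewrite ge0_fin_numE; last exact: Lnorm_ge0.
    exact: Nf.
  by rewrite ltey_eq fin_num_poweR.
have I0 : (0 <= \int[m]_x (f x `^ p)%:E)%E.
  by apply: integral_ge0 => x _; rewrite lee_fin powR_ge0.
have mfp : measurable_fun [set: T] (fun x => (f x `^ p)%:E).
  by apply/measurable_EFinP; exact: measurableT_comp (measurable_powR p) mf.
exists (fine (\int[m]_x (f x `^ p)%:E)) => [|S S0]; first exact: fine_ge0.
rewrite EFinM fineK ?ge0_fin_numE// -ge0_integralZr ?lee_fin ?powR_ge0//; last first.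
  by move=> x _; rewrite lee_fin powR_ge0.
apply: ge0_le_integral => //.
- by move=> x _; rewrite lee_fin le_max lexx orbT.
- by apply: emeasurable_funM => //; exact: measurable_cst.
move=> x _; rewrite lee_fin ge_max mulr_ge0 ?powR_ge0// andbT.
have [fS|Sf] := leP (f x) S.
  by rewrite (@le_trans _ _ 0) ?subr_le0// mulr_ge0 ?powR_ge0.
have fx0 : 0 < f x by exact: lt_trans Sf.
apply: (@le_trans _ _ (f x)); first by rewrite lerBlDr lerDl ltW.
have {1}-> : f x = f x `^ p * f x `^ (1 - p).
  rewrite -powRD ?(gt_eqF fx0) ?implybT// (_ : p + (1 - p) = 1) ?powRr1 ?ltW//; ring.
rewrite ler_wpM2l ?powR_ge0// -opprB !powRN lef_pV2 ?posrE ?powR_gt0//.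
by apply: ge0_ler_powR; rewrite ?nnegrE ?ltW// subr_gt0.
Qed.

End tail.

Theorem corollary2 (R : realType) (d : nat) (L : R) (p : \bar R) (q : R)
    (dT : measure_display) (T : measurableType dT) (P : probability T R)
    (sigma : nat -> T -> 'rV[R]_d -> 'rV[R]_d) (f : 'rV[R]_d -> R) :
  (1 <= d)%N -> 0 < L -> (1 < p)%E -> (p^-1 + q%:E^-1 = 1)%E ->
  (forall i w, Omega R d (sigma i w)) ->
  (forall i, measurable_fun [set: T] (fun w => sigma i w 0)) ->
  mutually_independent P (fun i w => sigma i w 0) ->
  (forall i (B : set 'rV[R]_d), measurable B ->
    P [set w | B (sigma i w 0)] = reflection_law L B) ->
  f \in Lfun (lebesgue_rV R d) p ->
  (forall x, 0 <= f x) ->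
  (forall x, ~ eball L x -> f x = 0) ->
  exists C : R, \forall n \near \oo,
    (\int[P]_w 'N[lebesgue_rV R d]_1
       [(fun x => (polarize_seq (fun i => sigma i w) n f x)%:E - symm_fun f x)]
     <= (C * n%:R `^ (- q^-1))%:E)%E.
Proof.
case: d sigma f => // n sigma f _ L0 p1 pq OmegaS mX indepX lawX fLp f0 fL.
pose X i w := sigma i w 0.
have sigmaE i w : sigma i w = bisect (X i w).
  by have [_] := (OmegaE (sigma i w)).1 (OmegaS i w).
have law1 : @reflection_law R n.+1 L setT = 1%E.
  by rewrite -(lawX 0%N _ measurableT); exact: probability_setT.
have [k k0 lawge] := reflection_law_ge (ltn0Sn n) law1.
have Xge i (x : 'rV[R]_n.+1) (V : set 'rV[R]_n.+1) :
    measurable V -> V `<=` eball L -> enorm x < L ->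
    (forall y, V y -> enorm y != enorm x) ->
    (k%:E * lebesgue_rV R n.+1 V <= P [set w | V (bisect (X i w) x)])%E.
  move=> mV VL xL Vx.
  rewrite -[X in (_ <= X)%E]/(P [set w | [set a | V (bisect a x)] (sigma i w 0)]).
  rewrite lawX; first exact: lawge.
  apply: (@measurable_preimage_rV _ _ _ _ (fun a => bisect a x)) => //.
  by apply: measurable_bisect; [exact: measurable_id|exact: measurable_cst].
have mf : measurable_fun [set: 'rV[R]_n.+1] f := set_mem (sub_Lfun_mfun fLp).
have ff : finite_norm (lebesgue_rV R n.+1) p f := set_mem (sub_Lfun_finLfun fLp).
have main i S (a : R) : (0 < i)%N -> 0 <= S ->
    (\int[lebesgue_rV R n.+1]_x (Num.max (f x - S) 0)%:E <= a%:E)%E ->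
    (\int[P]_w 'N[lebesgue_rV R n.+1]_1
       [(fun x => (polarize_seq (fun i => sigma i w) i f x)%:E - symm_fun f x)]
     <= (2 * (S / (k * i%:R) + a))%:E)%E.
  move=> i0 S0 tail; rewrite EFinM.
  have sE w : (fun j => sigma j w) = (fun j => bisect (X j w)).
    by apply/funext => j; exact: sigmaE.
  under eq_integral do rewrite Lnorm1 sE.
  apply: (le_trans (expected_distance_le mX indepX L0 k0 Xge mf f0 fL i0 S0)).
  apply: lee_wpmul2l; first by rewrite lee_fin.
  by rewrite EFinD; exact: leeD.
(* In the extended reals 0^-1 = +oo, which cannot be a term of a sum equal to 1 next to the
   nonnegative p^-1. *)
have q0 : q != 0.
  apply/eqP => q0; have i0 : (0 <= p^-1)%E by rewrite inve_ge0 ltW// (lt_trans _ p1).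
  by move: pq i0; rewrite q0 inve0; case: (p^-1)%E.
case: p p1 pq {fLp} ff => [p| |//].
  rewrite lte_fin => p1; have p0 : 0 < p by rewrite (lt_trans _ p1).
  rewrite !inver (negbTE q0) gt_eqF// -EFinD => -[pq] ff.
  have [K K0 tail] := tail_le mf f0 p1 ff.
  (* For S = i^(1/p) both S / (k i) and K S^(1-p) are multiples of i^(1/p - 1) = i^(-1/q), with
     factors 1/k and K. *)
  exists (2 * (k^-1 + K)); near=> i.
  have i0 : (0 < i)%N by near: i; exists 1%N.
  have iR : (0 : R) < i%:R by rewrite ltr0n.
  have S0 : 0 < i%:R `^ p^-1 :> R by exact: powR_gt0.
  apply: le_trans (main i _ _ i0 (ltW S0) (tail _ S0)) _.
  rewrite lee_fin le_eqVlt; apply/orP; left; apply/eqP.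
  have qE : - q^-1 = p^-1 - 1 by rewrite -pq opprD addNKr.
  rewrite -powRrM mulrBr mulr1 mulVf ?gt_eqF// -qE.
  have -> : i%:R `^ p^-1 = i%:R `^ (- q^-1) * i%:R.
    by rewrite qE -[X in _ * X]powRr1 ?ler0n// -powRD ?(gt_eqF iR) ?implybT// subrK.
  by field; rewrite !gt_eqF.
move=> _ pq ff.
(* For p = +oo the conjugate exponent is 1, and with S = M only the term M / (k i) remains. *)
have q1 : q^-1 = 1.
  by move: pq; rewrite invey add0e inver (negbTE q0) => -[].
have mT : (0 < lebesgue_rV R n.+1 setT)%E.
  apply: (lt_le_trans (eball_measure_gt0 n.+1 L0)).
  by apply: le_measure; rewrite ?inE//; exact: measurable_eball.
have [M M0 tail] := tail_eq0 mf mT ff.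
exists (2 * (M / k)); near=> i.
have i0 : (0 < i)%N by near: i; exists 1%N.
have iR : (0 : R) < i%:R by rewrite ltr0n.
apply: le_trans (main i M 0 i0 M0 _) _; first by rewrite tail.
rewrite lee_fin addr0 q1 powR_inv1 ?ler0n// le_eqVlt; apply/orP; left; apply/eqP.
by field; rewrite !gt_eqF.
Unshelve. all: by end_near. Qed.
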